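(* Let $P$ be a dynamic path with $|P|=n+1$ vertices (as in the context), let $k$ be an integer with $1\le k\le n+1$ and let $\alpha>0$ be real. Then whether $\Theta^k(P)\le\alpha$ can be decided in $O(|P|\log|P|)$ time; moreover, if $\Theta^k(P)\le\alpha$, the procedure also outputs a $k$-sink evacuation protocol for $P$ with evacuation time at most $\alpha$, i.e., a partition of $P$ into consecutive subpaths $Q_1,\dots,Q_k$ and sinks $y_j\in Q_j$ with $\max_{1\le j\le k}\Theta(Q_j,y_j)\le\alpha$.
   Context: A dynamic path $P$ consists of real points (vertices) $x_0<\dots<x_n$, edges $e_i=(x_{i-1},x_i)$, a constant $\tau>0$ (time to travel unit distance) with every $|x_i-x_j|\tau$ an integer, nonnegative integer weights $w_i$ (people at $x_i$) and positive integer capacities $c_i$ of $e_i$; $|P|=n+1$. For $a\le b$, $P_{a,b}$ is the dynamic subpath on vertices $x_a,\dots,x_b$ with the same weights, capacities and $\tau$; a point $y\in Q$ for a subpath $Q=P_{a,b}$ means $y\in[x_a,x_b]$. Discrete evacuation model on a path $Q$ with sink $y$: everyone moves toward $y$; time is discrete; at each vertex people wait in a FIFO queue to enter the next edge toward $y$; at each integer time step at most $c_i$ people may enter $e_i$, entering as soon as capacity and the queue permit; distance $d$ takes time $d\tau$; people starting at $y$ are evacuated at time $0$. $\Theta_L(Q,y)$ (resp. $\Theta_R(Q,y)$) is the time at which all people on vertices of $Q$ strictly left (resp. right) of $y$ have reached $y$, and $\Theta(Q,y)=\max(\Theta_L(Q,y),\Theta_R(Q,y))$. A $k$-sink evacuation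 protocol for $P$ is a choice of indices $0=i_0<i_1<\dots<i_k=n+1$, giving subpaths $Q_j=P_{i_{j-1},i_j-1}$ ($1\le j\le k$), together with sinks $y_j\in Q_j$; its time is $\max_j\Theta(Q_j,y_j)$. $\Theta^k(P)$ is the minimum time over all $k$-sink evacuation protocols for $P$. *)

(* Defs.v *)
From mathcomp Require Import all_boot all_order all_algebra.
From mathcomp Require Import classical_sets reals.

Set Implicit Arguments.
Unset Strict Implicit.
Unset Printing Implicit Defensive.
Import Order.TTheory GRing.Theory Num.Theory.

Local Open Scope ring_scope.
Local Open Scope classical_set_scope.

(* Vertices are x_0 < ... < x_n with n = dp_n; only x_i, w_i with i <= n and
   c_i with 1 <= i <= n (the capacity of e_i = (x_(i-1), x_i)) are meaningful,
   the values of the functions outside these ranges are never used.          *)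
Record dynpath (R : realType) := DynPath {
  dp_n : nat;
  dp_x : nat -> R;
  dp_w : nat -> nat;
  dp_c : nat -> nat;
  dp_tau : R;
  dp_x_lt : forall i, (i < dp_n)%N -> dp_x i < dp_x i.+1;
  dp_c_gt0 : forall i, (1 <= i <= dp_n)%N -> (0 < dp_c i)%N;
  dp_tau_gt0 : 0 < dp_tau;
  dp_travel_int : forall i j, (i <= dp_n)%N -> (j <= dp_n)%N ->
    `|dp_x i - dp_x j| * dp_tau \is a Num.int
}.

Definition dp_size (R : realType) (P : dynpath R) : nat := (dp_n P).+1.

(* People are anonymous: FIFO determines who leaves a queue but not how many
   leave it, so the dynamics only records head counts.

   queue c w arr t is the number of people standing at a vertex at time t, just
   before boarding, when w people start there, arr s people arrive at time s
   and the outgoing edge admits c people per time step.  Subtraction on nat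
   is truncated, so a queue shorter than c empties.                          *)
Fixpoint queue (c w : nat) (arr : nat -> nat) (t : nat) : nat :=
  match t with
  | 0 => (w + arr 0)%N
  | t'.+1 => (queue c w arr t' - c + arr t'.+1)%N
  end.

Definition boarding (c w : nat) (arr : nat -> nat) (t : nat) : nat :=
  minn c (queue c w arr t).

(* Number of people who enter the edge leaving vertex m at time t when everyone
   moves along the vertices 0, 1, 2, ... in this order; w m people start at
   vertex m, and the edge from m to m.+1 has capacity c m and travel time d m. *)
Fixpoint outflow (w c d : nat -> nat) (m : nat) : nat -> nat :=
  boarding (c m) (w m)
    (match m with
     | 0 => fun=> 0%N
     | m'.+1 => fun t =>
         if (d m' <= t)%N then outflow w c d m' (t - d m')%N else 0%N
     end).

(* With N vertices before the sink, the last of them at travel time delta from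
   the sink: by time T everybody has reached the sink.                       *)
Definition evacuated_by (R : realType) (w c d : nat -> nat) (N : nat)
    (delta T : R) : Prop :=
  exists h : nat,
    (\sum_(t < h | (t%:R + delta <= T)%R) outflow w c d N.-1 t)%N =
    (\sum_(m < N) w m)%N.

Definition evac_time (R : realType) (w c d : nat -> nat) (N : nat)
    (delta : R) : R :=
  inf [set T : R | 0 <= T /\ evacuated_by w c d N delta T].

Section Evacuation.
Variables (R : realType) (P : dynpath R).

Let x := dp_x P.
Let tau := dp_tau P.

(* Travel time along e_i, a positive integer by dp_travel_int.               *)
Definition travel (i : nat) : nat := Num.truncn ((x i - x i.-1) * tau).

Definition nb_left (a b : nat) (y : R) : nat :=
  count (fun i => x i < y) (index_iota a b.+1).

Definition nb_right (a b : nat) (y : R) : nat :=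
  count (fun i => y < x i) (index_iota a b.+1).

(* Evacuation of the subpath P_{a,b} to the sink y.  On the left of y people
   traverse x_a, x_(a+1), ... ; on the right x_b, x_(b-1), ...               *)
Definition Theta_L (a b : nat) (y : R) : R :=
  let N := nb_left a b y in
  evac_time (fun m => dp_w P (a + m)) (fun m => dp_c P (a + m).+1)
    (fun m => travel (a + m).+1) N ((y - x (a + N.-1)) * tau).

Definition Theta_R (a b : nat) (y : R) : R :=
  let N := nb_right a b y in
  evac_time (fun m => dp_w P (b - m)) (fun m => dp_c P (b - m))
    (fun m => travel (b - m)) N ((x (b - N.-1)%N - y) * tau).

Definition Theta (a b : nat) (y : R) : R :=
  Num.max (Theta_L a b y) (Theta_R a b y).

(* The part Q_(j+1) is P_{i j, (i j.+1).-1} and its sink is y j, for j < k.  *)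
Definition protocol (k : nat) (i : nat -> nat) (y : nat -> R) : Prop :=
  [/\ i 0%N = 0%N, i k = dp_size P,
      forall j, (j < k)%N -> (i j < i j.+1)%N
    & forall j, (j < k)%N -> x (i j) <= y j <= x (i j.+1).-1].

(* Evacuation times are nonnegative, so 0 is neutral for the maximum.        *)
Definition protocol_time (k : nat) (i : nat -> nat) (y : nat -> R) : R :=
  \big[Num.max/0]_(j < k) Theta (i j) (i j.+1).-1 (y j).

Definition Theta_opt (k : nat) : R :=
  inf [set T : R | exists i y, protocol k i y /\ T = protocol_time k i y].

End Evacuation.

(* Real RAM with unit-cost operations.  The memory consists of integer arrays
   and real arrays; arrays are named by numbers fixed in the program, their
   cells are addressed by computed integers, and scalars are single cells.
   There is no rounding operation from reals to integers, and the only
   constants are integers.                                                   *)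
Inductive iexp :=
  | IConst of int
  | ILoad of nat & iexp
  | IAdd of iexp & iexp
  | ISub of iexp & iexp
  | IMul of iexp & iexp
  | IDiv of iexp & iexp.

Inductive rexp :=
  | ROfInt of iexp
  | RLoad of nat & iexp
  | RAdd of rexp & rexp
  | RSub of rexp & rexp
  | RMul of rexp & rexp
  | RDiv of rexp & rexp.

Inductive bexp :=
  | BLeI of iexp & iexp
  | BLeR of rexp & rexp
  | BNot of bexp
  | BAnd of bexp & bexp.

Inductive cmd :=
  | CSkip
  | CStoreI of nat & iexp & iexp
  | CStoreR of nat & iexp & rexp
  | CSeq of cmd & cmd
  | CIf of bexp & cmd & cmd
  | CWhile of bexp & cmd.

Section Semantics.
Variable R : realType.

Record state := State {
  imem : nat -> int -> int;
  rmem : nat -> int -> R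
}.

Definition update (T : Type) (mem : nat -> int -> T) (a : nat) (i : int) (v : T)
    : nat -> int -> T :=
  fun b j => if (b == a) && (j == i) then v else mem b j.

Fixpoint ieval (s : state) (e : iexp) : int :=
  match e with
  | IConst z => z
  | ILoad a i => imem s a (ieval s i)
  | IAdd e1 e2 => ieval s e1 + ieval s e2
  | ISub e1 e2 => ieval s e1 - ieval s e2
  | IMul e1 e2 => ieval s e1 * ieval s e2
  | IDiv e1 e2 => divz (ieval s e1) (ieval s e2)
  end.

Fixpoint reval (s : state) (e : rexp) : R :=
  match e with
  | ROfInt e1 => (ieval s e1)%:~R
  | RLoad a i => rmem s a (ieval s i)
  | RAdd e1 e2 => reval s e1 + reval s e2
  | RSub e1 e2 => reval s e1 - reval s e2
  | RMul e1 e2 => reval s e1 * reval s e2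
  | RDiv e1 e2 => reval s e1 / reval s e2
  end.

Fixpoint beval (s : state) (b : bexp) : bool :=
  match b with
  | BLeI e1 e2 => ieval s e1 <= ieval s e2
  | BLeR e1 e2 => reval s e1 <= reval s e2
  | BNot b1 => ~~ beval s b1
  | BAnd b1 b2 => beval s b1 && beval s b2
  end.

(* exec p s t s': started in s, p halts in s' after t steps.  Each assignment
   and each test is one step: the expressions of a fixed program have bounded
   size, so this is the number of elementary operations up to a factor that
   depends only on the program.                                              *)
Inductive exec : cmd -> state -> nat -> state -> Prop :=
  | ExecSkip s : exec CSkip s 1 s
  | ExecStoreI a i e s :
      exec (CStoreI a i e) s 1
        (State (update (imem s) a (ieval s i) (ieval s e)) (rmem s))
  | ExecStoreR a i e s :
      exec (CStoreR a i e) s 1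
        (State (imem s) (update (rmem s) a (ieval s i) (reval s e)))
  | ExecSeq p1 p2 s1 s2 s3 t1 t2 :
      exec p1 s1 t1 s2 -> exec p2 s2 t2 s3 ->
      exec (CSeq p1 p2) s1 (t1 + t2) s3
  | ExecIfT b p1 p2 s1 s2 t :
      beval s1 b -> exec p1 s1 t s2 -> exec (CIf b p1 p2) s1 t.+1 s2
  | ExecIfF b p1 p2 s1 s2 t :
      ~~ beval s1 b -> exec p2 s1 t s2 -> exec (CIf b p1 p2) s1 t.+1 s2
  | ExecWhileF b p s : ~~ beval s b -> exec (CWhile b p) s 1 s
  | ExecWhileT b p s1 s2 s3 t1 t2 :
      beval s1 b -> exec p s1 t1 s2 -> exec (CWhile b p) s2 t2 s3 ->
      exec (CWhile b p) s1 (t1 + t2).+1 s3.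

(* Input layout: integer array 0 holds |P|, k; integer array 1 holds w_0..w_n;
   integer array 2 holds c_1..c_n in cells 1..n; real array 0 holds tau, alpha;
   real array 1 holds x_0..x_n.  All other cells contain 0.                  *)
Definition input (P : dynpath R) (k : nat) (alpha : R) : state :=
  State
    (fun a j =>
       match a, j with
       | 0, Posz 0 => (dp_size P)%:Z
       | 0, Posz 1 => k%:Z
       | 1, Posz i => if (i <= dp_n P)%N then (dp_w P i)%:Z else 0
       | 2, Posz i => if (1 <= i <= dp_n P)%N then (dp_c P i)%:Z else 0
       | _, _ => 0
       end)
    (fun a j =>
       match a, j with
       | 0, Posz 0 => dp_tau P
       | 0, Posz 1 => alpha
       | 1, Posz i => if (i <= dp_n P)%N then dp_x P i else 0
       | _, _ => 0
       end).

(* Output layout: cell 0 of integer array 3 holds the answer (1 for yes, 0 for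
   no); integer array 4 holds i_0..i_k; real array 2 holds the k sinks.      *)
Definition answers (s : state) (b : bool) : Prop :=
  imem s 3 0 = (nat_of_bool b)%:Z.

Definition outputs (s : state) (k : nat) (i : nat -> nat) (y : nat -> R) : Prop :=
  (forall j, (j <= k)%N -> imem s 4 j%:Z = (i j)%:Z) /\
  (forall j, (j < k)%N -> rmem s 2 j%:Z = y j).

End Semantics.

(* Main.v *)
(* Everybody left of a sink y reaches it by time alpha iff for every vertex x_i
   left of y with W_i > 0 people on x_a..x_i, and every edge e between x_i and y,
   (W_i - 1) div c_e + (y - x_i) tau <= alpha: consecutive vertices act as one
   server of the least capacity on the way. Hence the demands on y from the left
   are downward closed in y, those from the right upward closed, and a subpath
   of a feasible path is feasible. So greedy is optimal: part j takes as many
   vertices as is possible with one sink, but leaves at least one vertex to each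
   later part, which yields exactly k parts.

   The sink of a part starting at x_a is the furthest y allowed by all x_i left
   of it; the limit set by x_i is found by binary descent over a sparse table of
   least capacities. Then the last vertex is cut back by each x_q right of y, by
   binary descent over the prefix sums of the weights. Each vertex is visited
   a bounded number of times and costs O(log n).

   Theta_opt is an infimum over real sinks. It is attained because infeasibility
   of a subpath at alpha persists at alpha + eps, uniformly over the finitely
   many subpaths. *)
Require Import Defs.
From mathcomp Require Import all_boot all_order all_algebra.
From mathcomp Require Import boolp classical_sets reals exp.
From mathcomp Require Import zify ring lra.

Set Implicit Arguments.
Unset Strict Implicit.
Unset Printing Implicit Defensive.
Import Order.TTheory GRing.Theory Num.Theory.
Local Open Scope ring_scope.

(** * Dynamics of a queueing line *)

Section Discharge.
Variables w c d : nat -> nat.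
Local Open Scope nat_scope.

Let dist i m := \sum_(i <= l < m) d l.
Let total i m := \sum_(i <= l < m) w l.
Let departed m t := \sum_(s < t) outflow w c d m s.

(** Conservation of people. Truncated subtraction is harmless because boarding is the minimum of
    capacity and queue. *)
Lemma queue_sum_boarding k v arr t :
  queue k v arr t + \sum_(s < t) boarding k v arr s = v + \sum_(s < t.+1) arr s.
Proof.
elim: t => [|t IH] /=; first by rewrite big_ord0 big_ord1 addn0.
rewrite [in RHS]big_ord_recr /= addnA -IH big_ord_recr /= {2}/boarding.
by move: (\sum_(s < t) _) => S; lia.
Qed.

(** The queue is eliminated: cumulative departures obey a min-plus recursion in the cumulative
    arrivals, which suits the double induction over vertices and time in [leq_departed]. *)
Lemma sum_boardingS k v arr t :
  \sum_(s < t.+1) boarding k v arr s =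
  minn (\sum_(s < t) boarding k v arr s + k) (v + \sum_(s < t.+1) arr s).
Proof.
rewrite big_ord_recr /= -(queue_sum_boarding k) {2}/boarding.
by move: (\sum_(s < t) _) => S; lia.
Qed.

Lemma sum_delay (f : nat -> nat) k t :
  \sum_(s < t) (if k <= s then f (s - k) else 0) = \sum_(s < t - k) f s.
Proof.
elim: t => [|t IH]; first by rewrite sub0n !big_ord0.
rewrite big_ord_recr /= IH; case: leqP => kt.
  by rewrite subSn // big_ord_recr.
by rewrite addn0; have [-> ->] : t - k = 0 /\ t.+1 - k = 0 by lia.
Qed.

Lemma departed0 m : departed m 0 = 0.
Proof. by rewrite /departed big_ord0. Qed.

Lemma departed_head t : departed 0 t.+1 = minn (departed 0 t + c 0) (w 0).
Proof. by rewrite /departed sum_boardingS big1_eq addn0. Qed.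

Lemma departedS m t :
  departed m.+1 t.+1 =
  minn (departed m.+1 t + c m.+1) (w m.+1 + departed m (t.+1 - d m)).
Proof. by rewrite /departed sum_boardingS sum_delay. Qed.

(* The vertices i..m act together as one server of rate the least capacity on
   the way, delayed by the travel time: a minimum of such servers. *)
Lemma leq_departed m t K :
  K <= departed m t <->
  K <= total 0 m.+1 /\
  forall i e, i <= e <= m -> K <= total i.+1 m.+1 + c e * (t - dist i m).
Proof.
have tot0 i : total i i = 0 by rewrite /total big_geq.
have dis0 i : dist i i = 0 by rewrite /dist big_geq.
elim: m t K => [|m IHm]; elim=> [|t IHt] K.
- rewrite departed0; split; first by case: K => // _; split.
  by case=> _ /(_ 0 0 isT); rewrite tot0 muln0.
- rewrite departed_head leq_min addnC -leq_subLR.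
  have -> : total 0 1 = w 0 by rewrite /total big_nat1.
  split=> [/andP[]|[H1 H2]].
    rewrite IHt => -[_ H] H1; split=> // i e ie0.
    have [-> ->] : i = 0 /\ e = 0 by lia.
    have := H 0 0 isT; rewrite tot0 dis0 !subn0; lia.
  have := H2 0 0 isT; rewrite H1 andbT IHt tot0 dis0 => H.
  split; first by rewrite /total big_nat1; lia.
  move=> i e ie0; have [-> ->] : i = 0 /\ e = 0 by lia.
  by rewrite tot0 dis0; lia.
- rewrite departed0; split.
    by case: K => // _; split.
  by case=> _ /(_ m.+1 m.+1); rewrite leqnn tot0 sub0n muln0; exact.
- have tot i : i <= m.+1 -> total i m.+2 = total i m.+1 + w m.+1.
    by move=> im; rewrite /total big_nat_recr.
  have dis i : i <= m -> dist i m.+1 = dist i m + d m.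
    by move=> im; rewrite /dist big_nat_recr.
  rewrite departedS leq_min addnC -!leq_subLR.
  split=> [/andP[]|[H1 H2]].
    rewrite IHt => -[Ha Hb] /IHm[Hc Hd]; split.
      by rewrite tot //; lia.
    move=> i e /andP[ie em].
    have [im|im] := leqP i m; last first.
      have [-> ->] : i = m.+1 /\ e = m.+1 by lia.
      have := Hb m.+1 m.+1; rewrite leqnn tot0 dis0 !subn0 => /(_ isT); lia.
    rewrite tot // dis //.
    have [em'|em'] := leqP e m.
      have := Hd i e; rewrite ie em' => /(_ isT).
      have -> : t.+1 - (dist i m + d m) = t.+1 - d m - dist i m by lia.
      lia.
    have {em em'} -> : e = m.+1 by lia.
    (* Once the delay is over, one more time step adds one batch [c m.+1]. Before that the truncated
       time is 0 and the bound comes from vertex [m]. *)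
    have [lt|lt] := leqP (dist i m + d m) t.
      have := Hb i m.+1; rewrite leqnn tot // dis // (leqW im) => /(_ isT).
      by rewrite subSn // mulnS; lia.
    have := Hd i m; rewrite im leqnn => /(_ isT).
    have -> : t.+1 - (dist i m + d m) = 0 by lia.
    have -> : t.+1 - d m - dist i m = 0 by lia.
    lia.
  apply/andP; split.
    rewrite IHt; split; first lia.
    move=> i e /andP[ie em].
    have := H2 i e; have := H2 i m.+1; rewrite ie em leqnn (leq_trans ie em).
    move=> /(_ isT) Hm /(_ isT) He.
    (* In the first case either [c e <= c m.+1] and [He] suffices, or edge [m.+1] is the slower one
       and [Hm] suffices. *)
    have [lt|lt] := leqP (dist i m.+1) t.
      rewrite subSn // !mulnS in Hm He; nia.
    have z : t.+1 - dist i m.+1 = 0 by lia.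
    by rewrite z muln0 in He; lia.
  rewrite IHm; split; first by move: H1; rewrite tot //; lia.
  move=> i e /andP[ie em].
  have := H2 i e; rewrite ie (leqW em) => /(_ isT).
  rewrite tot; last by lia.
  rewrite dis; last by lia.
  have -> : t.+1 - (dist i m + d m) = t.+1 - d m - dist i m by lia.
  by rewrite leq_subLR addnA [w _ + _]addnC.
Qed.

(** This is [leq_departed] with [K] equal to everybody: the people after vertex [i] appear on both
    sides and cancel. *)
Lemma departed_all m t :
  departed m t = total 0 m.+1 <->
  forall i e, i <= e <= m -> total 0 i.+1 <= c e * (t - dist i m).
Proof.
have split_tot i e : i <= e <= m -> total 0 m.+1 = total 0 i.+1 + total i.+1 m.+1.
  by move=> ie; rewrite /total -big_cat_nat //; lia.
split=> [E i e ie|H].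
  have [_ /(_ i e ie)] := (leq_departed m t (total 0 m.+1)).1 (eq_leq (esym E)).
  by rewrite (split_tot i e ie); lia.
have [le_tot _] := (leq_departed m t (departed m t)).1 (leqnn _).
apply/eqP; rewrite eqn_leq le_tot /=.
apply/leq_departed; split=> // i e ie; rewrite (split_tot i e ie).
by have := H i e ie; lia.
Qed.

Section Deadline.
Variables (R : realType) (m : nat) (delta T : R).
Hypothesis c_gt0 : forall e, e <= m -> 0 < c e.

(** The times counted by [evacuated_by] are downward closed, which turns its sum into a cumulative
    departure count. *)
Lemma sum_until (p : pred nat) (f : nat -> nat) h :
  (forall t u, t <= u -> p u -> p t) ->
  exists t, (forall u, u < t -> p u) /\ \sum_(s < h | p s) f s = \sum_(s < t) f s.
Proof.
move=> pdown; elim: h => [|h [t [pt IH]]]; first by exists 0; rewrite !big_ord0.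
case ph : (p h); last by exists t; rewrite big_mkcond big_ord_recr /= ph addn0 -big_mkcond.
exists h.+1; split; first by move=> u uh; apply: pdown ph.
by apply: eq_bigl => s; apply: pdown ph; rewrite -ltnS.
Qed.

Lemma evacuated_byP :
  evacuated_by w c d m.+1 delta T <->
  forall i e, i <= e <= m -> 0 < total 0 i.+1 ->
  ((((total 0 i.+1).-1 %/ c e + dist i m)%N)%:R + delta <= T)%R.
Proof.
have totE : \sum_(i < m.+1) w i = total 0 m.+1 by rewrite /total big_mkord.
have down t u : t <= u -> (u%:R + delta <= T)%R -> (t%:R + delta <= T)%R.
  by move=> tu; apply: le_trans; rewrite lerD2r ler_nat.
rewrite /evacuated_by totE; split=> [[h]|H].
  have [t [pt ->]] := sum_until (outflow w c d m) h down.
  move/departed_all => H i e ie tot_gt0; have := H i e ie.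
  have ce := c_gt0 (andP ie).2.
  (* For [q > 0] people, [q <= c * s] holds iff [(q - 1) %/ c < s]; this is where the quotient comes
     from. *)
  move=> le_tot; have lt_t : (total 0 i.+1).-1 %/ c e + dist i m < t.
    have : (total 0 i.+1).-1 %/ c e < t - dist i m.
      by rewrite ltn_divLR // mulnC prednK.
    by lia.
  exact: pt lt_t.
have [tot0|tot_gt0] := posnP (total 0 m.+1); first by exists 0; rewrite big_ord0.
have T_ge0 : (0 <= T - delta)%R.
  rewrite subr_ge0; have := H m m (introT andP (conj (leqnn _) (leqnn _))) tot_gt0.
  by apply: le_trans; rewrite lerDr.
(* This horizon consists of exactly the times [t] with [t + delta <= T], so the filter in the sum
   becomes trivial. *)
exists (Num.truncn (T - delta)%R).+1.
rewrite (eq_bigl predT); last first.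
  move=> s /=; rewrite -lerBrDr -truncn_ge_nat // -ltnS; exact: ltn_ord.
apply/departed_all => i e ie.
have [->//|i_gt0] := posnP (total 0 i.+1).
have := H i e ie i_gt0; rewrite -lerBrDr -truncn_ge_nat // => le_t.
have : (total 0 i.+1).-1 %/ c e < (Num.truncn (T - delta)%R).+1 - dist i m.
  by rewrite ltn_subRL addnC.
by rewrite ltn_divLR ?c_gt0 ?(andP ie).2 // mulnC prednK.
Qed.

End Deadline.

(** Each condition bounds every admissible [T] from below, hence also the infimum, which is
    therefore attained. *)
Lemma evac_time_le (R : realType) m (delta T : R) :
  (forall e, e <= m -> 0 < c e) -> (0 <= T)%R ->
  (evac_time w c d m.+1 delta <= T)%R <->
  forall i e, i <= e <= m -> 0 < total 0 i.+1 ->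
  ((((total 0 i.+1).-1 %/ c e + dist i m)%N)%:R + delta <= T)%R.
Proof.
move=> c_gt0 T_ge0; rewrite /evac_time; set E := [set _ | _]%classic.
have E_lb : lbound E 0%R by move=> t [].
split=> [inf_le i e ie tot_gt0|H]; last first.
  by apply: ge_inf; [exists 0%R|split=> //; apply/evacuated_byP].
apply: le_trans inf_le; apply: lb_le_inf; last first.
  by move=> t [_ /(evacuated_byP _ _ c_gt0)]; exact.
have sum_mono (f : nat -> nat) j l k :
    j <= l <= k -> (\sum_(j <= s < l) f s <= \sum_(0 <= s < k) f s)%N.
  move=> /andP[jl lk]; rewrite (big_cat_nat (leq0n j)) /=; last exact: leq_trans jl lk.
  by rewrite (big_cat_nat jl lk) /=; lia.
(* A crude deadline that is always met, so the infimum is over a nonempty set. *)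
exists ((total 0 m.+1 + dist 0 m)%N%:R + `|delta|)%R; split.
  by rewrite addr_ge0.
apply/evacuated_byP => // j f jf tot_j; apply: lerD; last exact: ler_norm.
rewrite ler_nat leq_add ?sum_mono //; last by lia.
apply: leq_trans (leq_div _ _) _; apply: leq_trans (leq_pred _) _.
by apply: sum_mono; lia.
Qed.
End Discharge.

(** * Reaching a sink by a deadline *)

(** It turns the counts [nb_left] and [nb_right] into index bounds. *)
Lemma count_iota_down (p : pred nat) a s :
  (forall i j, (a <= i <= j)%N -> (j < a + s)%N -> p j -> p i) ->
  forall i, (a <= i < a + s)%N -> p i = (i < a + count p (iota a s))%N.
Proof.
elim: s => [|s IH] pdown i ai; first by lia.
have [pas|npas] := boolP (p (a + s)%N).
  have /eqP -> : count p (iota a s.+1) == size (iota a s.+1).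
    rewrite -all_count; apply/allP => j; rewrite mem_iota => /andP[aj js]; apply: pdown pas; lia.
  by rewrite size_iota (andP ai).2; apply: pdown pas; lia.
have {}IH := IH (fun i j ij js => pdown i j ij (ltn_trans js (eq_leq (esym (addnS a s))))).
rewrite -[s.+1]addn1 iotaD count_cat /= (negbTE npas) !addn0.
have [ias|ias] := ltnP i (a + s); first by rewrite IH //; lia.
have -> : i = (a + s)%N by lia.
rewrite (negbTE npas) ltn_add2l ltnNge.
by rewrite -[X in (_ <= X)%N](size_iota a s) count_size.
Qed.

Section Path.
Variables (R : realType) (P : dynpath R).
Local Notation n := (dp_n P).
Local Notation x := (dp_x P).
Local Notation w := (dp_w P).
Local Notation c := (dp_c P).
Local Notation tau := (dp_tau P).

Lemma x_lt i j : (i < j <= n)%N -> x i < x j.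
Proof.
case/andP; elim: j => // j IH; rewrite ltnS leq_eqVlt => /orP[/eqP->|ij] jn.
  exact: dp_x_lt.
exact: lt_trans (IH ij (ltnW jn)) (dp_x_lt jn).
Qed.

Lemma x_le i j : (i <= j <= n)%N -> x i <= x j.
Proof.
by case/andP; rewrite leq_eqVlt => /orP[/eqP->//|ij] jn; rewrite ltW ?x_lt ?ij.
Qed.

Lemma x_le_idx i j : (i <= n)%N -> x i <= x j -> (i <= j)%N.
Proof. by move=> i_n; apply: contraTT; rewrite -ltnNge -ltNge => ji; rewrite x_lt ?ji. Qed.

Lemma x_lt_idx i j : (i <= n)%N -> x i < x j -> (i < j)%N.
Proof. by move=> i_n; apply: contraTT; rewrite -leqNgt -leNgt => ji; rewrite x_le ?ji. Qed.

Lemma travelE i : (i < n)%N -> (travel P i.+1)%:R = (x i.+1 - x i) * tau.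
Proof.
move=> i_n; rewrite /travel /=; apply: truncnK.
have x_diff : 0 <= x i.+1 - x i by rewrite subr_ge0 ltW ?dp_x_lt.
rewrite natrEint mulr_ge0 ?(ltW (dp_tau_gt0 P)) // andbT.
by rewrite -(ger0_norm x_diff); apply: dp_travel_int => //; exact: ltnW.
Qed.

Definition people a b := (\sum_(a <= m < b.+1) w m)%N.

Lemma people_geq a a' b b' : (a <= a')%N -> (b' <= b)%N -> (people a' b' <= people a b)%N.
Proof.
move=> aa bb; rewrite /people.
have [ba|ba] := leqP b'.+1 a'; first by rewrite big_geq.
rewrite [leqRHS](big_cat_nat aa) /=; last by lia.
rewrite [X in (_ <= _ + X)%N](big_cat_nat (ltnW ba)) /=; lia.
Qed.

Section Bound.
Variable alpha : R.

(* The last of q people who board at rate c waits (q - 1) div c; the least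
   capacity on the way enters by quantifying over the edges e. *)
Definition reachL a (y : R) := forall i e, (a <= i < e)%N -> (e <= n)%N -> x e.-1 < y ->
  (0 < people a i)%N -> ((people a i).-1 %/ c e)%:R + (y - x i) * tau <= alpha.

Definition reachR b (y : R) := forall i e, (0 < e <= i)%N -> (i <= b)%N -> y < x e ->
  (0 < people i b)%N -> ((people i b).-1 %/ c e)%:R + (x i - y) * tau <= alpha.

Lemma reachL_mono a a' y y' : (a <= a')%N -> y' <= y -> reachL a y -> reachL a' y'.
Proof.
move=> aa yy L i e aie en ey W.
have := L i e _ en (lt_le_trans ey yy) (leq_trans W (people_geq aa (leqnn i))).
have -> : (a <= i < e)%N by lia.
move=> /(_ isT); apply: le_trans; apply: lerD; last by rewrite ler_pM2r ?dp_tau_gt0 // lerD2r.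
by rewrite ler_nat leq_div2r // -!subn1 leq_sub2r // people_geq.
Qed.

Lemma reachR_mono b b' y y' : (b' <= b)%N -> y <= y' -> reachR b y -> reachR b' y'.
Proof.
move=> bb yy L i e ei ib ey W.
have := L i e ei (leq_trans ib bb) (le_lt_trans yy ey)
          (leq_trans W (people_geq (leqnn i) bb)).
apply: le_trans; apply: lerD; last by rewrite ler_pM2r ?dp_tau_gt0 // lerD2l lerN2.
by rewrite ler_nat leq_div2r // -!subn1 leq_sub2r // people_geq.
Qed.

Lemma reachL_start a : (a <= n)%N -> reachL a (x a).
Proof. by move=> an i e aie en /x_lt_idx; lia. Qed.

Lemma reachR_end b : (b <= n)%N -> reachR b (x b).
Proof. by move=> bn i e ei ib /x_lt_idx; lia. Qed.

Hypothesis alpha_ge0 : 0 <= alpha.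

Lemma evac_time0 u v d delta : evac_time u v d 0 delta <= alpha.
Proof.
apply: ge_inf; first by exists 0 => t [].
by split=> //; exists 0%N; rewrite !big_ord0.
Qed.

Variables (a b : nat) (y : R).
Hypotheses (ab : (a <= b <= n)%N) (y_ab : x a <= y <= x b).

(** Position [m] of the line is vertex [a + m], left by edge [(a + m).+1]. Travel times telescope
    and, with the last leg to the sink, give [(y - x i) * tau]; the edges with [x e.-1 < y] are
    those leaving a vertex left of [y]. *)
Lemma Theta_L_le : Theta_L P a b y <= alpha <-> reachL a y.
Proof.
have [[a_le_b b_le_n] [ay yb]] := (andP ab, andP y_ab).
have left i : (a <= i <= b)%N -> (x i < y) = (i < a + nb_left P a b y)%N.
  move=> aib; apply: (@count_iota_down (fun i => x i < y) a (b.+1 - a)); last by lia.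
  by move=> j k jk kb; apply: le_lt_trans; apply: x_le; lia.
rewrite /Theta_L; move: (nb_left P a b y) left => N left.
have Nb : (a + N <= b)%N.
  by rewrite leqNgt -left ?a_le_b ?leqnn // -leNgt.
case: N left Nb => [|m] left Nb.
  split=> _; last exact: evac_time0.
  move=> i e aie en ey; have eb : (e <= b)%N.
    by have /x_lt_idx := lt_le_trans ey yb; lia.
  by move: ey; rewrite left; lia.
rewrite evac_time_le //=; last by move=> e em; apply: dp_c_gt0; lia.
have tot i : (\sum_(0 <= l < i.+1) w (a + l))%N = people a (a + i).
  by rewrite /people -{2}[a]add0n big_addn -addnS addKn; apply: eq_bigr => l _; rewrite addnC.
have dis i k : (i <= k <= m)%N ->
    (\sum_(i <= l < k) travel P (a + l).+1)%N%:R = (x (a + k) - x (a + i)) * tau.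
  case/andP => ik; move: ik; elim: k => [|k IH].
    by rewrite leqn0 => /eqP-> _; rewrite big_geq // subrr mul0r.
  rewrite leq_eqVlt => /orP[/eqP<- _|ik km]; first by rewrite big_geq // subrr mul0r.
  rewrite big_nat_recr //= natrD IH ?travelE //; [|lia..].
  by rewrite -mulrDl addnS; congr (_ * _); ring.
split=> H i e.
  move=> aie en ey W; have eb : (e <= b)%N.
    by have /x_lt_idx := lt_le_trans ey yb; lia.
  have em : (e.-1 < a + m.+1)%N by rewrite -left //; lia.
  have := H (i - a)%N (e.-1 - a)%N; rewrite tot subnKC; last by lia.
  have -> : (a + (e.-1 - a)).+1 = e by lia.
  have -> : (i - a <= e.-1 - a <= m)%N by lia.
  move=> /(_ isT W); rewrite natrD dis; last by lia.
  by rewrite subnKC ?(andP aie).1 // -addrA -mulrDl [x _ - _ + _]addrC subrKA.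
move=> ie W; rewrite tot in W *.
rewrite natrD dis; last by lia.
rewrite -addrA -mulrDl [x _ - _ + _]addrC subrKA; apply: H W; first by lia.
  by lia.
by rewrite /= left; lia.
Qed.

Lemma Theta_R_le : Theta_R P a b y <= alpha <-> reachR b y.
Proof.
have [[a_le_b b_le_n] [ay yb]] := (andP ab, andP y_ab).
have right i : (a <= i <= b)%N -> (y < x i) = (b < i + nb_right P a b y)%N.
  (* Vertices right of [y] form a final segment, so the counting lemma is applied to the
     complementary predicate. *)
  move=> aib; have := @count_iota_down (fun i => x i <= y) a (b.+1 - a).
  have -> : count (fun i => x i <= y) (iota a (b.+1 - a)) = (b.+1 - a - nb_right P a b y)%N.
    have := count_predC (fun i => y < x i) (iota a (b.+1 - a)); rewrite size_iota.
    have -> : count (predC (fun i => y < x i)) =1 count (fun i => x i <= y).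
      by apply: eq_count => j /=; rewrite leNgt.
    by rewrite /nb_right /index_iota; lia.
  move=> down; rewrite ltNge down; [|by move=> j k jk kb; apply: le_trans; apply: x_le; lia|lia].
  have : (nb_right P a b y <= b.+1 - a)%N by rewrite -[leqRHS](size_iota a) count_size.
  by lia.
rewrite /Theta_R; move: (nb_right P a b y) right => N right.
have Nb : (N <= b - a)%N.
  by have := right a; rewrite a_le_b leqnn ltNge ay => /(_ isT); lia.
case: N right Nb => [|m] right Nb.
  split=> _; last exact: evac_time0.
  move=> i e ei ib ey; have ae : (a <= e)%N.
    by have /x_lt_idx := le_lt_trans ay ey; lia.
  by move: ey; rewrite right; lia.
rewrite evac_time_le //=; last by move=> e em; apply: dp_c_gt0; lia.
have tot i : (i <= m)%N -> (\sum_(0 <= l < i.+1) w (b - l))%N = people (b - i) b.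
  rewrite /people; elim: i => [|i IH] im; first by rewrite subn0 big_nat1 subn0 big_nat1.
  rewrite big_nat_recr //= IH; last exact: ltnW.
  rewrite (@big_ltn _ _ _ (b - i.+1)); last by lia.
  have -> : (b - i.+1).+1 = (b - i)%N by lia.
  by rewrite addnC.
have dis i k : (i <= k <= m)%N ->
    (\sum_(i <= l < k) travel P (b - l))%N%:R = (x (b - i) - x (b - k)) * tau.
  case/andP => ik; move: ik; elim: k => [|k IH].
    by rewrite leqn0 => /eqP-> _; rewrite big_geq // subrr mul0r.
  rewrite leq_eqVlt => /orP[/eqP<- _|ik km]; first by rewrite big_geq // subrr mul0r.
  rewrite big_nat_recr //= natrD IH //; last by lia.
  have -> : (b - k = (b - k.+1).+1)%N by lia.
  rewrite travelE; last by lia.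
  by rewrite -mulrDl; congr (_ * _); ring.
split=> H i e.
  move=> ei ib ey W; have ae : (a <= e)%N.
    by have /x_lt_idx := le_lt_trans ay ey; lia.
  have em : (b < e + m.+1)%N by rewrite -right //; lia.
  have := H (b - i)%N (b - e)%N; rewrite tot; last by lia.
  rewrite !subKn //; last by lia.
  have -> : (b - i <= b - e <= m)%N by lia.
  move=> /(_ isT W); rewrite natrD dis; last by lia.
  by rewrite subKn // -addrA -mulrDl subrKA.
move=> ie; rewrite tot; last by lia.
move=> W; rewrite natrD dis; last by lia.
rewrite -addrA -mulrDl subrKA; apply: H W; [lia|lia|].
by rewrite right; lia.
Qed.

Lemma Theta_le : Theta P a b y <= alpha <-> reachL a y /\ reachR b y.
Proof. by rewrite -Theta_L_le -Theta_R_le ge_max; split=> /andP. Qed.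
End Bound.

(** * Subpaths served by one sink within a deadline *)

Definition feasible alpha a b :=
  exists y, [/\ x a <= y <= x b, reachL alpha a y & reachR alpha b y].

(** The sink is projected onto the smaller interval: at an end of it the demands from that side
    vanish, and those from the other side only relax. *)
Lemma feasible_sub alpha a a' b b' : (a <= a')%N -> (a' <= b')%N -> (b' <= b)%N -> (b <= n)%N ->
  feasible alpha a b -> feasible alpha a' b'.
Proof.
move=> aa ab bb bn [y [/andP[ay yb] Ly Ry]].
have [ya|ay'] := leP y (x a').
  exists (x a'); split; first by rewrite lexx x_le; lia.
    by apply: reachL_start; lia.
  by apply: reachR_mono Ry.
have [yb'|yb'] := leP y (x b').
  exists y; split; first by rewrite (ltW ay').
    exact: reachL_mono Ly.
  exact: reachR_mono Ry.
exists (x b'); split; first by rewrite lexx x_le; lia.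
  by apply: reachL_mono Ly => //; exact: ltW.
by apply: reachR_end; lia.
Qed.

(** The supremum of the allowed sinks is allowed because edge [e] counts only for [x e.-1 < y],
    strictly: a demand violated at the supremum is already violated slightly to its left. *)
Lemma reachL_max alpha a b : (a <= b <= n)%N ->
  exists2 y, x a <= y <= x b & forall z, z <= x b -> reachL alpha a z <-> z <= y.
Proof.
move=> ab; have xab : x a <= x b by rewrite x_le.
pose A := [set z : R | z <= x b /\ reachL alpha a z]%classic.
have A_a : A (x a) by split=> //; apply: reachL_start; lia.
have A_sup : has_sup A by split; [exists (x a)|exists (x b) => z []].
have A_ub z : A z -> z <= sup A by apply: sup_upper_bound.
exists (sup A); first by rewrite A_ub //= ge_sup //; [exists (x a)|move=> z []].
move=> z zb; split=> [Lz|]; first by apply: A_ub.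
move=> zA; apply: reachL_mono (leqnn a) zA _ => i e aie en ei W.
rewrite leNgt; apply/negP; set q := _%:R; set s := sup A => gt_alpha.
(* Any [u > s - eps] still lies beyond [x e.-1] and still exceeds [alpha]. *)
pose eps := Num.min (s - x e.-1) ((q + (s - x i) * tau - alpha) / tau).
have eps_gt0 : 0 < eps by rewrite lt_min subr_gt0 ei divr_gt0 ?subr_gt0 ?dp_tau_gt0.
have [u [ub Lu]] := sup_adherent eps_gt0 A_sup; rewrite -/s ltrBlDr -ltrBlDl lt_min => /andP[ue ui].
have eu : x e.-1 < u by lra.
have := Lu i e aie en eu W; rewrite -/q leNgt => /negP; apply; move: ui; rewrite ltr_pdivlMr ?dp_tau_gt0 //; lra.
Qed.

(** Let [Y] be the furthest sink allowed from the left. Infeasibility makes some right demand fail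
    at [Y] by an excess [eta]. A slightly larger deadline still forces the sink to [Y + delta] or
    beyond, where a left demand fails by a margin. *)
Lemma feasible_right_closed alpha a b : (a <= b <= n)%N -> ~ feasible alpha a b ->
  exists2 eps, 0 < eps & ~ feasible (alpha + eps) a b.
Proof.
move=> ab infeas; have [Y /andP[aY Yb] maxY] := reachL_max alpha ab.
have [i [e [ei ib eY W]]] : exists i e, [/\ (0 < e <= i)%N, (i <= b)%N, Y < x e,
    (0 < people i b)%N & alpha < ((people i b).-1 %/ c e)%:R + (x i - Y) * tau].
  apply: contrapT => none; apply: infeas; exists Y; split; rewrite ?aY //; first exact/maxY.
  move=> i e ei ib eY W; rewrite leNgt; apply/negP => gt_alpha.
  by apply: none; exists i, e.
set q := _%:R => late; pose eta := q + (x i - Y) * tau - alpha.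
have tau_gt0 := dp_tau_gt0 P.
have eta_gt0 : 0 < eta by rewrite /eta; lra.
(* The first term spends half of the excess; the second keeps sinks before [Y + delta] left of
   [x e], so that edge [e] still counts. *)
pose delta := Num.min (eta / 2 / tau) (x e - Y).
have delta_gt0 : 0 < delta by rewrite lt_min subr_gt0 eY !divr_gt0.
have delta_e : Y + delta <= x e by rewrite -lerBrDl ge_min lexx orbT.
have delta_eta : delta * tau <= eta / 2 by rewrite -ler_pdivlMr // ge_min lexx.
have eb : x e <= x b by rewrite x_le //; lia.
(* Some left demand already fails at this midpoint; a sink at [Y + delta] overshoots it by at least
   [delta / 2 * tau], which [eps] cannot absorb. *)
pose z := Y + delta / 2.
have [i' [e' [ai' en' ez W']]] : exists i e, [/\ (a <= i < e)%N, (e <= n)%N, x e.-1 < z,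
    (0 < people a i)%N & alpha < ((people a i).-1 %/ c e)%:R + (z - x i) * tau].
  apply: contrapT => none; suff /maxY : reachL alpha a z by rewrite /z; lra.
  move=> i' e' ai' en' ez W'; rewrite leNgt; apply/negP => gt_alpha.
  by apply: none; exists i', e'.
set q' := _%:R => late'.
exists (Num.min (eta / 2) (delta * tau / 2)).
  by rewrite lt_min !divr_gt0 ?mulr_gt0.
set eps := Num.min _ _ => -[y [_ Ly Ry]].
have eps1 : eps <= eta / 2 by rewrite ge_min lexx.
have eps2 : eps <= delta * tau / 2 by rewrite ge_min lexx orbT.
have yY : Y + delta <= y.
  rewrite leNgt; apply/negP => y_lt.
  have := Ry i e ei ib (lt_le_trans y_lt delta_e) W; rewrite -/q.
  have : (y - Y) * tau < delta * tau by rewrite ltr_pM2r //; lra.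
  by move: eps1 delta_eta; rewrite /eta; lra.
have := Ly i' e' ai' en' _ W'; rewrite -/q' /z in ez late' *.
have -> : x e'.-1 < y by lra.
move=> /(_ isT); have : (delta / 2) * tau <= (y - (Y + delta / 2)) * tau.
  by rewrite ler_pM2r //; lra.
by lra.
Qed.
End Path.

(** * Greedy protocols *)

Lemma common_eps (R : realType) (Q : nat -> R -> Prop) m :
  (forall p e e', 0 < e' <= e -> Q p e -> Q p e') ->
  (forall p, exists2 e, 0 < e & Q p e) ->
  exists2 e, 0 < e & forall p, (p < m)%N -> Q p e.
Proof.
move=> Qdown Qex; elim: m => [|m [e e_gt0 IH]]; first by exists 1.
have [e' e'_gt0 Qm] := Qex m; exists (Num.min e e'); first by rewrite lt_min e_gt0.
move=> p; rewrite ltnS leq_eqVlt => /orP[/eqP->|pm].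
  by apply: Qdown Qm; rewrite lt_min e_gt0 e'_gt0 ge_min lexx orbT.
by apply: Qdown (IH p pm); rewrite lt_min e_gt0 e'_gt0 ge_min lexx.
Qed.

Section Optimum.
Variables (R : realType) (P : dynpath R).
Local Notation n := (dp_n P).
Local Notation x := (dp_x P).

Lemma feasible_le alpha beta a b : alpha <= beta -> feasible P alpha a b -> feasible P beta a b.
Proof.
move=> ab [y [y_ab Ly Ry]]; exists y; split=> // i e ie en ey W; apply: le_trans ab.
  exact: Ly.
exact: Ry.
Qed.

(** Two nested uses of [common_eps], over [a] and [b]: a feasible subpath accepts any tolerance, an
    infeasible one gets it from [feasible_right_closed]. *)
Lemma feasible_uniform alpha :
  exists2 eps, 0 < eps &
    forall a b, (a <= b <= n)%N -> feasible P (alpha + eps) a b -> feasible P alpha a b.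
Proof.
have [|a|e e_gt0 H] := @common_eps R (fun a e => forall b, (b < n.+1)%N -> (a <= b)%N ->
    feasible P (alpha + e) a b -> feasible P alpha a b) n.+1.
- move=> a e e' /andP[_ ee] H b bn ab /feasible_le F; apply: H => //; apply: F; lra.
- have [|b|e e_gt0 H] := @common_eps R (fun b e => (a <= b <= n)%N ->
      feasible P (alpha + e) a b -> feasible P alpha a b) n.+1.
  + move=> b e e' /andP[_ ee] H ab /feasible_le F; apply: H => //; apply: F; lra.
  + have [ab|] := boolP (a <= b <= n)%N; last by exists 1.
    have [F|/(feasible_right_closed ab)[e e_gt0 NF]] := pselect (feasible P alpha a b).
      by exists 1.
    by exists e.
  + by exists e => // b bn ab; apply: H; rewrite ?ab.
by exists e => // a b ab; apply: H; lia.
Qed.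

Section Protocols.
Variables (k : nat) (i : nat -> nat) (y : nat -> R).
Hypothesis prot : protocol P k i y.

(** Each of the remaining [k - j] parts has at least one vertex. *)
Lemma protocol_idx j : (j <= k)%N -> (i j + (k - j) <= n.+1)%N.
Proof.
have [_ ik inc _] := prot.
move: {2}(k - j)%N (erefl (k - j)%N) => d; elim: d j => [|d IH] j dE jk.
  have -> : j = k by lia.
  by rewrite ik subnn addn0.
have := IH j.+1; have := inc j; lia.
Qed.

Lemma protocol_part j : (j < k)%N -> (i j <= (i j.+1).-1 <= n)%N.
Proof.
have [_ _ inc _] := prot => jk; have := inc j jk; have := protocol_idx jk; lia.
Qed.

Lemma protocol_time_le alpha : 0 <= alpha ->
  protocol_time P k i y <= alpha <->
  forall j, (j < k)%N -> reachL P alpha (i j) (y j) /\ reachR P alpha (i j.+1).-1 (y j).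
Proof.
move=> alpha_ge0; have [_ _ _ sink] := prot; rewrite /protocol_time.
split=> [/bigmax_leP[_ H] j jk|H].
  by rewrite -Theta_le ?protocol_part ?sink //; exact: (H (Ordinal jk)).
by apply/bigmax_leP; split=> // -[j jk] _; rewrite Theta_le ?protocol_part ?sink //; exact: H.
Qed.

(** If [i j <= g j], what remains of part [j] from [g j] on is a subpath of a feasible part, so
    greedy takes it too. The cap on [b] does no harm: by [protocol_idx] every part of a protocol
    ends within it. *)
Lemma greedy_ahead alpha g :
  (forall j, (j < k)%N -> feasible P alpha (i j) (i j.+1).-1) ->
  g 0%N = 0%N ->
  (forall j, (j < k)%N -> (g j < g j.+1)%N /\
    forall b, (g j <= b <= n.+1 - k + j)%N -> feasible P alpha (g j) b -> (b < g j.+1)%N) ->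
  forall j, (j <= k)%N -> (i j <= g j)%N.
Proof.
have [i0 _ inc _] := prot.
move=> feas g0 greedy; elim=> [|j IH] jk; first by rewrite i0 g0.
have [gj max_g] := greedy j jk; have := IH (ltnW jk) => ig.
have := inc j jk; have := protocol_part jk; have := protocol_idx jk => idx part inc_j.
have [gi|] := leqP (g j) (i j.+1).-1; last by lia.
suff : ((i j.+1).-1 < g j.+1)%N by lia.
apply: max_g; first by lia.
by apply: feasible_sub (feas j jk) => //; lia.
Qed.
End Protocols.

Lemma protocol_exists k : (1 <= k <= n.+1)%N -> exists i y, protocol P k i y.
Proof.
(* The first [k - 1] parts are single vertices and the last one takes the rest. *)
move=> k_n; exists (fun j => if j == k then n.+1 else j), (fun j => x j).
have ltk j : (j < k)%N -> (j == k) = false by lia.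
split=> [|| j jk | j jk]; rewrite ?eqxx //; first by case: eqP => //; lia.
  by rewrite ltk //; case: eqP => _; lia.
by rewrite ltk // lexx /= x_le //; case: eqP => _ /=; lia.
Qed.

Lemma protocol_time_ge0 k i y : 0 <= protocol_time P k i y.
Proof. exact: bigmax_ge_id. Qed.

Lemma Theta_opt_le k alpha : (1 <= k <= n.+1)%N -> 0 <= alpha ->
  Theta_opt P k <= alpha <-> exists i y, protocol P k i y /\ protocol_time P k i y <= alpha.
Proof.
move=> k_n alpha_ge0; rewrite /Theta_opt; set E := [set _ | _]%classic.
have E_lb : lbound E 0 by move=> _ [i [y [_ ->]]]; exact: protocol_time_ge0.
have E_inf : has_inf E.
  split; last by exists 0.
  by have [i [y p]] := protocol_exists k_n; exists (protocol_time P k i y), i, y.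
split=> [le_alpha|[i [y [p le_alpha]]]]; last first.
  by apply: le_trans le_alpha; apply: ge_inf; [exists 0|exists i, y].
(* A protocol within [eps] of the infimum has all parts feasible at [alpha + eps], hence at [alpha].
   Its partition is kept and its sinks are replaced. *)
have [eps eps_gt0 uniform] := feasible_uniform alpha.
have [_ [i [y [p ->]]] lt_eps] := inf_adherent eps_gt0 E_inf.
have : protocol_time P k i y <= alpha + eps by lra.
rewrite protocol_time_le // ?addr_ge0 //; last exact: ltW.
move=> reach; have [i0 ik inc sink] := p.
have /choice[z Hz] j : exists z, (j < k)%N -> [/\ x (i j) <= z <= x (i j.+1).-1,
    reachL P alpha (i j) z & reachR P alpha (i j.+1).-1 z].
  have [jk|_] := boolP (j < k)%N; last by exists 0.
  have [|z Fz] := uniform _ _ (protocol_part p jk); last by exists z.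
  by have [] := reach j jk; exists (y j); split=> //; exact: sink.
have pz : protocol P k i z by split=> // j jk; have [] := Hz j jk.
exists i, z; split=> //; rewrite protocol_time_le // => j jk.
by have [] := Hz j jk.
Qed.
End Optimum.

(** * Demands of single vertices *)

Section Search.
Variables (R : realType) (P : dynpath R) (alpha : R).
Local Notation n := (dp_n P).
Local Notation x := (dp_x P).
Local Notation c := (dp_c P).
Local Notation tau := (dp_tau P).

Definition least_cap i j v :=
  [/\ (i < j <= n)%N, (0 < v)%N, forall e, (i < e <= j)%N -> (v <= c e)%N &
      exists2 e, (i < e <= j)%N & c e = v].

Lemma least_cap1 i : (i < n)%N -> least_cap i i.+1 (c i.+1).
Proof.
move=> i_n; split; rewrite ?ltnSn //; first by apply: dp_c_gt0; lia.
  move=> e ie; suff -> : e = i.+1 by []; lia.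
by exists i.+1 => //; lia.
Qed.

(** Minima are idempotent, so the ranges may overlap. They do when a search still stands at [x_i]
    although its running minimum already includes edge [i.+1]. *)
Lemma least_cap_cat i j1 i2 j u v : (i <= i2 <= j1)%N -> (j1 <= j)%N ->
  least_cap i j1 u -> least_cap i2 j v -> least_cap i j (minn u v).
Proof.
move=> ij jj [ij1 u0 u_min [eu ieu cu]] [i2j v0 v_min [ev iev cv]].
split; [lia|lia| |].
  move=> e ie; have [ej|ej] := leqP e j1.
    by apply: leq_trans (geq_minl _ _) (u_min e _); lia.
  by apply: leq_trans (geq_minr _ _) (v_min e _); lia.
by case: (leqP u v) => uv; [exists eu => //; lia|exists ev => //; lia].
Qed.

(* The demand that x_i puts on a sink at y in a part that starts at x_a. *)
Definition condL a i y := forall e, (i < e <= n)%N -> x e.-1 < y ->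
  ((people P a i).-1 %/ c e)%:R + (y - x i) * tau <= alpha.

Lemma condL_mono a i y y' : y' <= y -> condL a i y -> condL a i y'.
Proof.
move=> yy L e ie ey; apply: le_trans (L e ie (lt_le_trans ey yy)).
by rewrite lerD2l ler_pM2r ?dp_tau_gt0 // lerD2r.
Qed.

Lemma condL_here a i : condL a i (x i).
Proof. by move=> e ie /x_lt_idx; lia. Qed.

Lemma reachL_condL a y :
  reachL P alpha a y <-> forall i, (a <= i)%N -> (0 < people P a i)%N -> condL a i y.
Proof.
split=> [L i ai W e ie ey|H i e aie en ey W].
  by apply: L => //; lia.
by apply: H => //; lia.
Qed.

Lemma condL_least a i j y v : least_cap i j v -> x j.-1 < y <= x j ->
  condL a i y <-> ((people P a i).-1 %/ v)%:R + (y - x i) * tau <= alpha.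
Proof.
move=> [ij v0 v_min [e0 ie0 cv]] /andP[jy yj]; split=> [L|le_alpha e ie ey].
  by rewrite -cv; apply: L; [lia|apply: le_lt_trans jy; apply: x_le; lia].
have /x_lt_idx : x e.-1 < x j by apply: lt_le_trans yj.
move=> ej; apply: le_trans le_alpha; rewrite lerD2r ler_nat leq_div2l ?v_min //; lia.
Qed.

Lemma condL_vertex a i j v : least_cap i j v ->
  condL a i (x j) <-> ((people P a i).-1 %/ v)%:R + (x j - x i) * tau <= alpha.
Proof.
move=> min_v; have [ij _ _ _] := min_v; apply: (condL_least _ min_v).
by rewrite lexx andbT x_lt //; lia.
Qed.

(** Between [x p] and [x p.+1] the edges on the way are fixed, so the demand is linear in [y] and
    solved by [rho]. Entering edge [p.+1] may lower the capacity and put [rho] before [x p]; the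
    limit is then [x p]. *)
Lemma condL_sink a i p v rho : (i <= p)%N -> condL a i (x p) -> ~ condL a i (x p.+1) ->
  least_cap i p.+1 v -> rho = x i + (alpha - ((people P a i).-1 %/ v)%:R) / tau ->
  forall y, condL a i y <-> y <= Num.max (x p) rho.
Proof.
move=> ip Lp NLp min_v -> y; have tau_gt0 := dp_tau_gt0 P.
set q := _%:R; have rhoE z : (z <= x i + (alpha - q) / tau) = (q + (z - x i) * tau <= alpha).
  rewrite -lerBlDl ler_pdivlMr //; apply/idP/idP; lra.
rewrite le_max; have [yp|py] /= := leP y (x p).
  by split=> // _; apply: condL_mono Lp.
rewrite rhoE; have [yp1|py1] := leP y (x p.+1).
  by apply: (condL_least _ min_v); rewrite /= py.
split=> [/(condL_mono (ltW py1))//|]; rewrite -rhoE => y_rho.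
case: NLp; apply/(condL_vertex _ min_v); rewrite -rhoE.
exact: le_trans (ltW py1) y_rho.
Qed.

(** Unlike in [condL], the sink is already fixed and the last vertex [b] is sought. The guard makes
    the condition vacuous for [b < i]. *)
Definition condR y i b := (0 < people P i b)%N -> forall e, (0 < e <= i)%N -> y < x e ->
  ((people P i b).-1 %/ c e)%:R + (x i - y) * tau <= alpha.

Lemma condR_mono y i b b' : (b' <= b)%N -> condR y i b -> condR y i b'.
Proof.
move=> bb H W e ei ey; have ww := people_geq P (leqnn i) bb.
apply: le_trans (H (leq_trans W ww) e ei ey).
by rewrite lerD2r ler_nat leq_div2r // -!subn1 leq_sub2r.
Qed.

Lemma condR_before y i b : (b < i)%N -> condR y i b.
Proof. by move=> bi; rewrite /condR /people big_geq. Qed.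

Lemma reachR_condR b y :
  reachR P alpha b y <-> forall i, (0 < i <= b)%N -> condR y i b.
Proof.
split=> [H i ib W e ei ey|H i e ei ib ey W].
  by apply: H => //; lia.
by apply: H => //; lia.
Qed.

Lemma condR_least m y i b v : least_cap m i v ->
  (forall e, (e <= n)%N -> (x e <= y) = (e <= m)%N) ->
  condR y i b <-> ((0 < people P i b)%N ->
    ((people P i b).-1 %/ v)%:R + (x i - y) * tau <= alpha).
Proof.
move=> [mi v0 v_min [e0 me0 cv]] y_m; split=> H W.
  by rewrite -cv; apply: H => //; [lia|rewrite ltNge y_m; lia].
move=> e ei ey; have em : (m < e)%N by move: ey; rewrite ltNge y_m; lia.
by apply: le_trans (H W); rewrite lerD2r ler_nat leq_div2l ?v_min //; lia.
Qed.
End Search.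

(** * Program logic with running time *)

Section Logic.
Variable R : realType.
Implicit Types (s : state R) (p : cmd) (Q : nat -> state R -> Prop).

(** Total correctness in existential form, as the theorem asks for a halting run; postconditions
    also read the number of steps. *)
Definition wp p s Q := exists t s', exec p s t s' /\ Q t s'.

Fixpoint int_writes p : seq nat :=
  match p with
  | CStoreI a _ _ => [:: a]
  | CSeq p1 p2 => int_writes p1 ++ int_writes p2
  | CIf _ p1 p2 => int_writes p1 ++ int_writes p2
  | CWhile _ p1 => int_writes p1
  | _ => [::]
  end.

Fixpoint real_writes p : seq nat :=
  match p with
  | CStoreR a _ _ => [:: a]
  | CSeq p1 p2 => real_writes p1 ++ real_writes p2
  | CIf _ p1 p2 => real_writes p1 ++ real_writes p2
  | CWhile _ p1 => real_writes p1
  | _ => [::]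
  end.

(** Arrays have static names, so what a program cannot change is read off its syntax, and invariants
    speak only of what is written. *)
Definition frame p s s' :=
  (forall a, a \notin int_writes p -> imem s' a = imem s a) /\
  (forall a, a \notin real_writes p -> rmem s' a = rmem s a).

Lemma frame_refl p s : frame p s s.
Proof. by []. Qed.

Lemma frame_trans p s1 s2 s3 : frame p s1 s2 -> frame p s2 s3 -> frame p s1 s3.
Proof.
move=> [i12 r12] [i23 r23]; split=> a aw; first by rewrite i23 ?i12.
by rewrite r23 ?r12.
Qed.

Lemma update_neq T (mem : nat -> int -> T) a i v b : b != a -> update mem a i v b = mem b.
Proof. by rewrite /update => /negbTE ->. Qed.

Lemma exec_frame p s t s' : exec p s t s' -> frame p s s'.
Proof.
elim=> {p s t s'} //=.
- by move=> a i e s; split=> //= b; rewrite inE => ba; rewrite update_neq.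
- by move=> a i e s; split=> //= b; rewrite inE => ba; rewrite update_neq.
- move=> p1 p2 s1 s2 s3 t1 t2 _ [i1 r1] _ [i2 r2].
  split=> a; rewrite mem_cat negb_or => /andP[a1 a2]; first by rewrite i2 ?i1.
  by rewrite r2 ?r1.
- move=> b p1 p2 s1 s2 t _ _ [i1 r1].
  by split=> a; rewrite mem_cat negb_or => /andP[a1 _]; auto.
- move=> b p1 p2 s1 s2 t _ _ [i2 r2].
  by split=> a; rewrite mem_cat negb_or => /andP[_ a2]; auto.
- by move=> b p s1 s2 s3 t1 t2 _ _ f1 _; apply: frame_trans.
Qed.

Lemma wp_frame p s Q : wp p s Q -> wp p s (fun t s' => frame p s s' /\ Q t s').
Proof. by move=> [t [s' [e q]]]; exists t, s'; split=> //; split=> //; apply: exec_frame e. Qed.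

Lemma wp_imp p s (Q Q' : nat -> state R -> Prop) :
  wp p s Q -> (forall t s', frame p s s' -> Q t s' -> Q' t s') -> wp p s Q'.
Proof. by move=> /wp_frame[t [s' [e [f q]]]] imp; exists t, s'; split=> //; apply: imp. Qed.

Lemma wp_skip s Q : Q 1%N s -> wp CSkip s Q.
Proof. by move=> q; exists 1%N, s; split=> //; constructor. Qed.

Lemma wp_storeI a i e s Q :
  Q 1%N (State (update (imem s) a (ieval s i) (ieval s e)) (rmem s)) -> wp (CStoreI a i e) s Q.
Proof. by move=> q; exists 1%N; eexists; split; [constructor|]. Qed.

Lemma wp_storeR a i e s Q :
  Q 1%N (State (imem s) (update (rmem s) a (ieval s i) (reval s e))) -> wp (CStoreR a i e) s Q.
Proof. by move=> q; exists 1%N; eexists; split; [constructor|]. Qed.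

Lemma wp_seq p1 p2 s Q :
  wp p1 s (fun t1 s1 => wp p2 s1 (fun t2 s2 => Q (t1 + t2)%N s2)) -> wp (CSeq p1 p2) s Q.
Proof.
move=> [t1 [s1 [e1 [t2 [s2 [e2 q]]]]]]; exists (t1 + t2)%N, s2.
by split=> //; apply: ExecSeq e1 e2.
Qed.

Lemma wp_if b p1 p2 s Q :
  (beval s b -> wp p1 s (fun t => Q t.+1)) -> (~~ beval s b -> wp p2 s (fun t => Q t.+1)) ->
  wp (CIf b p1 p2) s Q.
Proof.
move=> wp1 wp2; have [bs|bs] := boolP (beval s b).
  by have [t [s' [e q]]] := wp1 bs; exists t.+1, s'; split=> //; apply: ExecIfT.
by have [t [s' [e q]]] := wp2 bs; exists t.+1, s'; split=> //; apply: ExecIfF.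
Qed.

(** [J] takes a variant [r] and the steps [t] spent so far, so time bounds are part of the invariant
    and can be amortised over rounds. The successors on times pay for the tests. *)
Lemma wp_while (J : nat -> nat -> state R -> Prop) r b p s Q :
  (forall r t s', frame p s s' -> J r t s' -> beval s' b ->
    wp p s' (fun t' s'' => exists2 r', (r' < r)%N & J r' (t + t').+1 s'')) ->
  (forall r t s', frame p s s' -> J r t s' -> ~~ beval s' b -> Q t.+1 s') ->
  J r 0%N s -> wp (CWhile b p) s Q.
Proof.
move=> body exit J0.
have finish r' t s1 : frame p s s1 -> J r' t s1 -> ~~ beval s1 b ->
    wp (CWhile b p) s1 (fun t' => Q (t + t')%N).
  move=> f Jt bs; exists 1%N, s1; rewrite addn1.
  by split; [exact: ExecWhileF|exact: exit Jt bs].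
suff H m r' t s1 : (r' <= m)%N -> frame p s s1 -> J r' t s1 ->
    wp (CWhile b p) s1 (fun t' => Q (t + t')%N).
  exact: H (leqnn r) (frame_refl p s) J0.
elim: m r' t s1 => [|m IH] r' t s1 r_m f Jt;
    have [bs|bs] := boolP (beval s1 b); try exact: finish f Jt bs.
  by have [t' [s' [_ [r'' lt_r _]]]] := body r' t s1 f Jt bs; lia.
have [t' [s' [e [r'' lt_r Js']]]] := body r' t s1 f Jt bs.
have [|t2 [s2 [e2 q]]] := IH r'' (t + t').+1 s' _ (frame_trans f (exec_frame e)) Js'.
  by lia.
exists (t' + t2).+1, s2; split; first exact: ExecWhileT e e2.
by rewrite addnS addnA.
Qed.
End Logic.

(** * The program *)

(* Integer array 5 holds prefix sums of the weights; cell l * |P| + i of integer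
   array 6 holds the least capacity of the 2^l edges after x_i, and junk when
   i + 2^l > n. *)
Local Notation vT := 10%N.
Local Notation vLev := 11%N.
Local Notation vLen := 12%N.
Local Notation vJ := 13%N.
Local Notation vA := 14%N.
Local Notation vCap := 15%N.
Local Notation vI := 16%N.
Local Notation vPos := 17%N.
Local Notation vCm := 18%N.
Local Notation vLv := 19%N.
Local Notation vPp := 20%N.
Local Notation vB := 21%N.
Local Notation vQ := 22%N.
Local Notation vW := 23%N.
Local Notation vNm := 24%N.
Local Notation rY := 3%N.
Local Notation rRho := 4%N.

Declare Scope iexp_scope.
Delimit Scope iexp_scope with I.
Notation "a + b" := (IAdd a b) : iexp_scope.
Notation "a - b" := (ISub a b) : iexp_scope.
Notation "a * b" := (IMul a b) : iexp_scope.
Notation "a / b" := (IDiv a b) : iexp_scope.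
Notation "a $[ i ]" := (ILoad a i%I) (at level 2, format "a $[ i ]") : iexp_scope.
Notation "a <= b" := (BLeI a b) : iexp_scope.
Declare Scope rexp_scope.
Delimit Scope rexp_scope with Re.
Notation "a + b" := (RAdd a b) : rexp_scope.
Notation "a - b" := (RSub a b) : rexp_scope.
Notation "a * b" := (RMul a b) : rexp_scope.
Notation "a / b" := (RDiv a b) : rexp_scope.
Notation "a $[ i ]" := (RLoad a i%I) (at level 2, format "a $[ i ]") : rexp_scope.
Notation "a <= b" := (BLeR a b) : rexp_scope.
Notation "p ;; q" := (CSeq p q) (at level 61, right associativity).
Local Notation lit m := (IConst (Posz m)).
Local Notation iv v := (ILoad v (lit 0)).
Local Notation rv v := (RLoad v (lit 0)).
Local Notation seti v e := (CStoreI v (lit 0) e%I).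
Local Notation setr v e := (CStoreR v (lit 0) e%Re).
Local Notation inN := (iv 0).
Local Notation inK := (0%N$[lit 1])%I.
Local Notation inTau := (rv 0).
Local Notation inAlpha := (RLoad 0 (lit 1)).

Definition store_minI a i e1 e2 := CIf (BLeI e1 e2) (CStoreI a i e1) (CStoreI a i e2).
Definition store_minR a i e1 e2 := CIf (BLeR e1 e2) (CStoreR a i e1) (CStoreR a i e2).
Definition store_maxR a i e1 e2 := CIf (BLeR e1 e2) (CStoreR a i e2) (CStoreR a i e1).

Section Stores.
Variable R : realType.
Implicit Types (s : state R) (Q : nat -> state R -> Prop).

(** Stated over signed integers for table rows, where out-of-range cells hold values about which
    nothing is known. *)
Lemma wp_store_minZ a i e1 e2 s Q :
  Q 2%N (State (update (imem s) a (ieval s i) (Num.min (ieval s e1) (ieval s e2))) (rmem s)) ->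
  wp (store_minI a i e1 e2) s Q.
Proof.
move=> q; apply: wp_if => /= le; apply: wp_storeI; first by rewrite (min_idPl le) in q.
by rewrite (min_idPr _) // in q; apply: ltW; rewrite ltNge.
Qed.

Lemma wp_store_minI a i e1 e2 u v s Q : ieval s e1 = Posz u -> ieval s e2 = Posz v ->
  Q 2%N (State (update (imem s) a (ieval s i) (Posz (minn u v))) (rmem s)) ->
  wp (store_minI a i e1 e2) s Q.
Proof.
move=> E1 E2 q; apply: wp_store_minZ; rewrite E1 E2.
by have -> : Num.min (Posz u) (Posz v) = Posz (minn u v) by lia.
Qed.

Lemma wp_store_minR a i e1 e2 s Q :
  Q 2%N (State (imem s) (update (rmem s) a (ieval s i) (Num.min (reval s e1) (reval s e2)))) ->
  wp (store_minR a i e1 e2) s Q.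
Proof.
move=> q; apply: wp_if => /= le; apply: wp_storeR; first by rewrite (min_idPl le) in q.
by rewrite (min_idPr _) // in q; apply: ltW; rewrite ltNge.
Qed.

Lemma wp_store_maxR a i e1 e2 s Q :
  Q 2%N (State (imem s) (update (rmem s) a (ieval s i) (Num.max (reval s e1) (reval s e2)))) ->
  wp (store_maxR a i e1 e2) s Q.
Proof.
move=> q; apply: wp_if => /= le; apply: wp_storeR; first by rewrite (max_idPr le) in q.
by rewrite (max_idPl _) // in q; apply: ltW; rewrite ltNge.
Qed.
End Stores.

Definition init_prog :=
  CWhile (iv vT + lit 1 <= inN)%I (
    CStoreI 5 (iv vT + lit 1)%I (5%N$[iv vT] + 1%N$[iv vT])%I;;
    CStoreI 6 (iv vT) (2%N$[iv vT + lit 1])%I;;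
    seti vT (iv vT + lit 1)).

Definition row_prog :=
  CWhile (iv vT + lit 1 <= inN)%I (
    store_minI 6 ((iv vLev + lit 1) * inN + iv vT)%I
      (6%N$[iv vLev * inN + iv vT])%I (6%N$[iv vLev * inN + (iv vT + iv vLen)])%I;;
    seti vT (iv vT + lit 1)).

Definition table_prog :=
  seti vLen (lit 1);;
  CWhile (iv vLen + lit 1 <= inN)%I (
    seti vT (lit 0);;
    row_prog;;
    seti vLev (iv vLev + lit 1);;
    seti vLen (iv vLen + iv vLen)).

(** [vPos] advances by decreasing powers of two while [vCm] carries the least capacity met so far,
    so each probe needs a single table cell. *)
Definition descendL_prog :=
  CWhile (lit 1 <= iv vPp)%I (
    CIf (iv vPos + iv vPp <= iv vCap)%I (
      store_minI vNm (lit 0) (iv vCm) (6%N$[iv vLv * inN + iv vPos])%I;;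
      CIf (ROfInt ((iv vW - lit 1) / iv vNm)%I
             + (1%N$[iv vPos + iv vPp] - 1%N$[iv vI]) * inTau <= inAlpha)%Re
        (seti vPos (iv vPos + iv vPp);; seti vCm (iv vNm)) CSkip)
      CSkip;;
    seti vLv (iv vLv - lit 1);;
    seti vPp (iv vPp / lit 2)).

(* Lowers Y to the furthest sink at which the demand of x_i is met. *)
Definition clip_prog :=
  seti vCm (2%N$[iv vI + lit 1]);;
  seti vPos (iv vI);;
  seti vLv (iv vLev);;
  seti vPp (iv vLen);;
  descendL_prog;;
  CIf (iv vPos + lit 1 <= iv vCap)%I (
    store_minI vCm (lit 0) (iv vCm) (2%N$[iv vPos + lit 1])%I;;
    setr rRho (1%N$[iv vI] + (inAlpha - ROfInt ((iv vW - lit 1) / iv vCm)%I) / inTau);;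
    store_maxR rRho (lit 0) (1%N$[iv vPos])%Re (rv rRho);;
    store_minR rY (lit 0) (rv rY) (rv rRho))
    CSkip.

(** The scan stops at the first vertex not left of the current sink, since later ones make no demand
    from the left. The final test leaves in [vI] the index of the first vertex strictly right of the
    sink. *)
Definition sink_prog :=
  setr rY (1%N$[iv vCap]);;
  seti vI (iv vA);;
  CWhile (BNot (rv rY <= 1%N$[iv vI])%Re) (
    seti vW (5%N$[iv vI + lit 1] - 5%N$[iv vA]);;
    CIf (lit 1 <= iv vW)%I clip_prog CSkip;;
    seti vI (iv vI + lit 1));;
  CIf (1%N$[iv vI] <= rv rY)%Re (seti vI (iv vI + lit 1)) CSkip.

Definition descendR_prog :=
  CWhile (lit 1 <= iv vPp)%I (
    CIf (iv vPos + iv vPp <= iv vB)%I (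
      seti vW (5%N$[iv vPos + iv vPp + lit 1] - 5%N$[iv vQ]);;
      CIf (iv vW <= lit 0)%I
        (seti vPos (iv vPos + iv vPp))
        (CIf (ROfInt ((iv vW - lit 1) / iv vCm)%I
                + (1%N$[iv vQ] - rv rY) * inTau <= inAlpha)%Re
          (seti vPos (iv vPos + iv vPp)) CSkip))
      CSkip;;
    seti vPp (iv vPp / lit 2)).

(** With the sink fixed, the least capacity up to [x_q] is a running minimum, seeded by the capacity
    that the first round takes in again; only the weights are searched. *)
Definition end_prog :=
  seti vQ (iv vI);;
  seti vB (iv vCap);;
  seti vCm (2%N$[iv vQ]);;
  CWhile (iv vQ <= iv vB)%I (
    store_minI vCm (lit 0) (iv vCm) (2%N$[iv vQ])%I;;
    seti vPos (iv vQ - lit 1);;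
    seti vPp (iv vLen);;
    descendR_prog;;
    seti vB (iv vPos);;
    seti vQ (iv vQ + lit 1)).

(** The cap leaves one vertex to each later part. If the last vertex [vB] ends up left of the sink,
    the sink is moved back to it. *)
Definition part_prog :=
  seti vCap (inN - inK + iv vJ);;
  sink_prog;;
  end_prog;;
  seti vA (iv vB + lit 1);;
  store_minR 2 (iv vJ) (rv rY) (1%N$[iv vB])%Re;;
  CStoreI 4 (iv vJ + lit 1)%I (iv vA);;
  seti vJ (iv vJ + lit 1).

Definition evac_prog :=
  init_prog;;
  table_prog;;
  CWhile (iv vJ + lit 1 <= inK)%I part_prog;;
  CIf (inN <= iv vA)%I (seti 3 (lit 1)) (seti 3 (lit 0)).

(** * Correctness of the program *)

Section SinkPhase.
Variables (R : realType) (P : dynpath R) (k lg : nat) (alpha : R).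
Local Notation n := (dp_n P).
Local Notation x := (dp_x P).
Local Notation w := (dp_w P).
Local Notation c := (dp_c P).
Local Notation tau := (dp_tau P).
Implicit Types s : state R.

Definition prefix t := (\sum_(0 <= m < t) w m)%N.

Lemma prefix_people a i : (a <= i.+1)%N -> (prefix i.+1)%:Z - (prefix a)%:Z = (people P a i)%:Z.
Proof.
by move=> ai; rewrite /prefix /people (big_cat_nat (leq0n a) ai) /= PoszD addrC addKr.
Qed.

(** What preprocessing leaves behind and the main loop only reads. *)
Record ready s : Prop := Ready {
  ready_size : imem s 0 (Posz 0) = n.+1%:Z;
  ready_parts : imem s 0 (Posz 1) = k%:Z;
  ready_cap : forall i, (0 < i <= n)%N -> imem s 2 (Posz i) = (c i)%:Z;
  ready_prefix : forall i, (i <= n.+1)%N -> imem s 5 (Posz i) = (prefix i)%:Z;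
  ready_table : forall l i, (l <= lg)%N -> (i + 2 ^ l <= n)%N ->
    exists2 v, least_cap P i (i + 2 ^ l) v & imem s 6 (Posz (l * n.+1 + i)) = v%:Z;
  ready_lev : imem s vLev (Posz 0) = lg%:Z;
  ready_len : imem s vLen (Posz 0) = (2 ^ lg)%N%:Z;
  ready_lg : (n < 2 ^ lg)%N;
  ready_tau : rmem s 0 (Posz 0) = tau;
  ready_alpha : rmem s 0 (Posz 1) = alpha;
  ready_x : forall i, (i <= n)%N -> rmem s 1 (Posz i) = x i
}.

Lemma ready_frame p s s' : frame p s s' ->
  all (fun a => a \notin int_writes p) [:: 0; 2; 5; 6; vLev; vLen]%N &&
  all (fun a => a \notin real_writes p) [:: 0; 1]%N ->
  ready s -> ready s'.
Proof.
move=> [fi fr] /andP[/and5P[/fi i0 /fi i2 /fi i5 /fi i6 /and3P[/fi i11 /fi i12 _]]].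
move=> /and3P[/fr r0 /fr r1 _] [? ? ? ? ? ? ? ? ? ? ?].
by split; rewrite ?i0 ?i2 ?i5 ?i6 ?i11 ?i12 ?r0 ?r1.
Qed.

Lemma descendL_wp s a i cap :
  ready s -> (i < cap <= n)%N -> (0 < people P a i)%N ->
  imem s vI (Posz 0) = i%:Z -> imem s vCap (Posz 0) = cap%:Z ->
  imem s vW (Posz 0) = (people P a i)%:Z -> imem s vPos (Posz 0) = i%:Z ->
  imem s vCm (Posz 0) = (c i.+1)%:Z -> imem s vLv (Posz 0) = lg%:Z ->
  imem s vPp (Posz 0) = (2 ^ lg)%N%:Z ->
  wp descendL_prog s (fun t s' => (t <= 10 * (lg + 2))%N /\
    exists p v,
    [/\ imem s' vPos (Posz 0) = p%:Z /\ imem s' vCm (Posz 0) = v%:Z,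
        (i <= p <= cap)%N, least_cap P i (maxn p i.+1) v,
        condL P alpha a i (x p) & (p < cap)%N -> ~ condL P alpha a i (x p.+1)]).
Proof.
move=> rdy i_cap W_gt0 sI sCap sW sPos sCm sLv sPp.
(* The last good vertex lies in [[p, p + 2 ^ r)], with [r] rounds of at most 10 steps left and next
   jump [2 ^ r %/ 2], which is 0 at the end. *)
pose J r t s' := (r <= lg.+1)%N /\ (t + 10 * r <= 10 * lg.+1)%N /\
  imem s' vLv (Posz 0) = r%:Z - 1 /\ imem s' vPp (Posz 0) = ((2 ^ r) %/ 2)%N%:Z /\
  exists p v, [/\ imem s' vPos (Posz 0) = p%:Z /\ imem s' vCm (Posz 0) = v%:Z,
    (i <= p <= cap)%N, least_cap P i (maxn p i.+1) v, condL P alpha a i (x p)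
    & forall z, (i <= z <= cap)%N -> condL P alpha a i (x z) -> (z < p + 2 ^ r)%N].
apply: (wp_while (J := J) (r := lg.+1)).
- move=> r t s' fr [r_lg [t_r [Lv [Pp [p [v [[Pos Cm] ip min_v Lp max_p]]]]]]] /=.
  rewrite Pp; case: r => [//|r] in r_lg t_r Lv Pp max_p * => _.
  rewrite expnS mulKn // in Pp *.
  have [sz _ cc _ tab _ _ _ ta al xx] := ready_frame fr isT rdy.
  have finish p' v' s2 t2 : (t2 <= 7)%N -> imem s2 vLv (Posz 0) = r.+1%:Z - 1 ->
      imem s2 vPp (Posz 0) = (2 ^ r)%N%:Z -> imem s2 vPos (Posz 0) = p'%:Z ->
      imem s2 vCm (Posz 0) = v'%:Z -> (i <= p' <= cap)%N -> least_cap P i (maxn p' i.+1) v' ->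
      condL P alpha a i (x p') ->
      (forall z, (i <= z <= cap)%N -> condL P alpha a i (x z) -> (z < p' + 2 ^ r)%N) ->
      wp (seti vLv (iv vLv - lit 1);; seti vPp (iv vPp / lit 2)) s2
        (fun t3 s3 => exists2 r', (r' < r.+1)%N & J r' (t + (t2 + t3)).+1 s3).
    move=> t2_7 Lv2 Pp2 Pos2 Cm2 ip2 min2 Lp2 max2.
    apply: wp_seq; apply: wp_storeI; apply: wp_storeI; exists r => //; split; first lia.
    split; first lia.
    rewrite /= /update /= Lv2 Pp2; split; first lia.
    by split; [rewrite divz_nat|exists p', v'].
  apply: wp_seq; apply: wp_if => /=.
  + rewrite Pos Pp fr.1 // sCap => jump.
    have {}jump : (p + 2 ^ r <= cap)%N by lia.
    have [u min_u Tu] : exists2 u, least_cap P p (p + 2 ^ r) u &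
        imem s' 6 (Posz (r * n.+1 + p)) = u%:Z by apply: tab; lia.
    have idx : r.+1%:Z - 1 = r%:Z by lia.
    have {}Tu : imem s' 6 (imem s' vLv 0 * imem s' 0 0 + imem s' vPos 0) = u.
      by rewrite Lv sz Pos idx -Tu PoszD PoszM.
    have p_gt0 : (0 < 2 ^ r)%N by rewrite expn_gt0.
    have min_uv : least_cap P i (maxn (p + 2 ^ r) i.+1) (minn v u).
      have -> : maxn (p + 2 ^ r) i.+1 = (p + 2 ^ r)%N by lia.
      by apply: least_cap_cat min_v min_u; lia.
    have [_ uv_gt0 _ _] := min_uv.
    apply: wp_seq; apply: (wp_store_minI (u := v) (v := u)) => //=.
    have test : (((imem s' vW (Posz 0) - 1%Z) %/ (minn v u)%:Z)%Z%:~R +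
        (rmem s' 1 (imem s' vPos (Posz 0) + imem s' vPp (Posz 0)) -
         rmem s' 1 (imem s' vI (Posz 0))) * rmem s' 0 (Posz 0) <= rmem s' 0 (Posz 1)) <->
        condL P alpha a i (x (p + 2 ^ r)).
      rewrite Pos Pp -PoszD fr.1 // fr.1 // sW sI ta al !xx; try lia.
      have -> : (people P a i)%:Z - 1%Z = (people P a i).-1%:Z by lia.
      rewrite divz_nat (condL_vertex _ _ (j := p + 2 ^ r) (v := minn v u)) //.
      by move: min_uv; have -> : maxn (p + 2 ^ r) i.+1 = (p + 2 ^ r)%N by lia.
    apply: wp_if => /=.
      rewrite {1 2 3 4 5}/update /= => /test Lj; apply: wp_seq; apply: wp_storeI; apply: wp_storeI => /=.
      apply: (finish (p + 2 ^ r)%N (minn v u)) => //; first by rewrite /= /update /= Pos Pp.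
        lia.
      by move=> z zi /max_p; rewrite expnS; lia.
    rewrite {1 2 3 4 5}/update /= => /negP NLj.
    apply: wp_skip; apply: (finish p v) => // z zi Lz.
    rewrite ltnNge; apply/negP => zp; apply: NLj; apply/test.
    by apply: condL_mono Lz; apply: x_le; lia.
  + rewrite Pos Pp fr.1 // sCap => jump; apply: wp_skip.
    by apply: (finish p v) => // z; lia.
- move=> r t s' fr [r_lg [t_r [Lv [Pp [p [v [[Pos Cm] ip min_v Lp max_p]]]]]]] /=.
  rewrite Pp => stop; split; first by lia.
  exists p, v; split=> // p_cap Lp1.
  have r0 : r = 0%N by case: r stop {max_p t_r Lv Pp r_lg} => // r; rewrite expnS mulKn //; lia.
  by have := max_p p.+1; rewrite r0 expn0 => /(_ _ Lp1); lia.
rewrite /J; split=> //; split; first lia.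
split; first by rewrite sLv; lia.
split; first by rewrite sPp expnS mulKn.
exists i, (c i.+1); split=> //; first lia.
- by rewrite (maxn_idPr _) //; apply: least_cap1; lia.
- exact: condL_here.
- move=> z zi _; have := ready_lg rdy; rewrite expnS; lia.
Qed.

Lemma ready_eta s : ready s -> ready (State (imem s) (rmem s)).
Proof. by case: s. Qed.

Lemma ready_storeI mi mr v j z : v \notin [:: 0; 2; 5; 6; vLev; vLen]%N ->
  ready (State mi mr) -> ready (State (update mi v j z) mr).
Proof.
rewrite !inE !negb_or => /and5P[v0 v2 v5 v6 /andP[v11 v12]] [? ? ? ? ? ? ? ? ? ? ?].
by split; rewrite /= ?update_neq 1?eq_sym.
Qed.

Lemma ready_storeR mi mr v j z : v \notin [:: 0; 1]%N ->
  ready (State mi mr) -> ready (State mi (update mr v j z)).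
Proof.
rewrite !inE !negb_or => /andP[v0 v1] [? ? ? ? ? ? ? ? ? ? ?].
by split; rewrite /= ?update_neq 1?eq_sym.
Qed.

(** If the search reaches [cap], the demand of [x_i] is met up to [x cap]; otherwise [condL_sink]
    gives the limit on the edge after [p]. As [x i <= rho], no vertex pulls the sink behind
    itself. *)
Lemma clip_wp s a i cap Y :
  ready s -> (i < cap <= n)%N -> (0 < people P a i)%N -> Y <= x cap ->
  imem s vI (Posz 0) = i%:Z -> imem s vCap (Posz 0) = cap%:Z ->
  imem s vW (Posz 0) = (people P a i)%:Z -> rmem s rY (Posz 0) = Y ->
  wp clip_prog s (fun t s' => (t <= 20 * (lg + 2))%N /\
    exists rho, [/\ rmem s' rY (Posz 0) = Num.min Y rho, x i <= rho &
      forall y, y <= x cap -> condL P alpha a i y <-> y <= rho]).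
Proof.
move=> rdy i_cap W_gt0 Y_cap sI sCap sW sY.
have i1 : imem s vI (Posz 0) + Posz 1 = i.+1%:Z by rewrite sI; lia.
do 4 (apply: wp_seq; apply: wp_storeI => /=).
have i1_n : (0 < i.+1 <= n)%N by lia.
apply: wp_seq; set s0 := State _ _.
have rdy0 : ready s0 by do 4 (apply: ready_storeI => //); exact: ready_eta.
apply: (wp_imp (descendL_wp rdy0 i_cap W_gt0 _ _ _ _ _ _ _)); rewrite /= /update //=.
- by rewrite i1; apply: (ready_cap rdy).
- exact: (ready_lev rdy).
- exact: (ready_len rdy).
move=> t s1 fr [t_lg [p [v [[Pos Cm] ip min_v Lp NLp]]]].
have [sz _ cc _ tab _ _ _ ta al xx] := ready_frame fr isT rdy0.
have Cap1 : imem s1 vCap (Posz 0) = cap%:Z by rewrite fr.1.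
have I1 : imem s1 vI (Posz 0) = i%:Z by rewrite fr.1.
have W1 : imem s1 vW (Posz 0) = (people P a i)%:Z by rewrite fr.1.
have Y1 : rmem s1 rY (Posz 0) = Y by rewrite fr.2.
have p1 : imem s1 vPos (Posz 0) + Posz 1 = p.+1%:Z by rewrite Pos; lia.
apply: wp_if => /=; rewrite p1 Cap1 => p_cap; last first.
  apply: wp_skip; split; first lia.
  have pE : p = cap by lia.
  rewrite pE in Lp.
  exists (x cap); split; first by rewrite Y1 (min_idPl Y_cap).
    by apply: x_le; lia.
  by move=> y y_cap; split=> // _; apply: condL_mono Lp.
have {}p_cap : (p < cap)%N by lia.
have min_p : least_cap P i p.+1 (minn v (c p.+1)).
  have min1 : least_cap P p p.+1 (c p.+1) by apply: least_cap1; lia.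
  by apply: least_cap_cat min_v min1; lia.
apply: wp_seq; apply: (wp_store_minI (u := v) (v := c p.+1)) => //=.
  by rewrite p1; apply: cc; lia.
apply: wp_seq; apply: wp_storeR => /=; rewrite /update /=.
apply: wp_seq; apply: wp_store_maxR => /=; rewrite /update /=.
apply: wp_store_minR => /=; rewrite /update /=.
split; first by lia.
rewrite Y1 I1 W1 Pos ta al !xx; try lia.
have -> : (people P a i)%:Z - 1%Z = (people P a i).-1%:Z by lia.
rewrite divz_nat; set rho := x i + _; exists (Num.max (x p) rho); split=> //.
  by rewrite le_max x_le //; lia.
have {}ip : (i <= p)%N by lia.
by move=> y _; apply: (condL_sink ip Lp (NLp p_cap) min_p).
Qed.

Lemma sink_wp s a cap : ready s -> (a <= cap <= n)%N ->
  imem s vA (Posz 0) = a%:Z -> imem s vCap (Posz 0) = cap%:Z ->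
  wp sink_prog s (fun t s' => exists m Y,
    [/\ imem s' vI (Posz 0) = m%:Z /\ rmem s' rY (Posz 0) = Y,
      (t <= 30 * (lg + 2) * (m - a).+1)%N, x a <= Y <= x cap,
      (a < m <= cap.+1)%N /\ (forall i, (i <= n)%N -> (x i <= Y) = (i < m)%N) &
      forall y, y <= x cap -> reachL P alpha a y <-> y <= Y]).
Proof.
move=> rdy a_cap sA sCap.
apply: wp_seq; apply: wp_storeR; apply: wp_seq; apply: wp_storeI => /=.
apply: wp_seq; set s0 := State _ _.
have rdy0 : ready s0.
  by apply: ready_storeI => //; apply: ready_storeR => //; exact: ready_eta.
set G := (30 * (lg + 2))%N.
(* [Y] is the furthest sink allowed by the vertices scanned so far, all of which lie at or left of
   [Y]. *)
pose J r t s' := exists i Y, [/\ imem s' vI (Posz 0) = i%:Z /\ rmem s' rY (Posz 0) = Y,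
  (t <= G * (i - a))%N /\ (r + i = cap)%N, x a <= Y <= x cap, (a <= i)%N /\
  (forall i', (a < i')%N -> (i' <= i)%N -> x i'.-1 <= Y) &
  forall y, y <= x cap -> y <= Y <->
    (forall i', (a <= i' < i)%N -> (0 < people P a i')%N -> condL P alpha a i' y)].
apply: (wp_while (J := J) (r := (cap - a)%N)).
- move=> r t s1 fr [i [Y [[sI sY] [t_i r_i] /andP[aY Ycap] [ai xY] Ymax]]] /=.
  have rdy1 := ready_frame fr isT rdy0.
  have [sz _ cc pre tab _ _ _ ta al xx] := rdy1.
  rewrite sI sY xx; last by lia.
  rewrite -ltNge => i_Y.
  have i_cap : (i < cap)%N by apply: (@x_lt_idx _ P); [lia|exact: lt_le_trans Ycap].
  apply: wp_seq; apply: wp_storeI => /=; apply: wp_seq.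
  have -> : imem s1 5 (imem s1 vI (Posz 0) + 1%Z) - imem s1 5 (imem s1 vA (Posz 0)) =
      (people P a i)%:Z.
    rewrite sI (fr.1 vA) //= /update /= sA -prefix_people; last by lia.
    have -> : i%:Z + 1%Z = i.+1%:Z by lia.
    by rewrite !pre //; lia.
  set s2 := State _ _.
  have rdy2 : ready s2 by apply: ready_storeI => //; exact: ready_eta.
  have finish t2 s3 rho : (t2 <= 22 * (lg + 2))%N -> imem s3 vI (Posz 0) = i%:Z ->
      rmem s3 rY (Posz 0) = Num.min Y rho -> x i <= rho ->
      (forall y, y <= x cap -> y <= Y -> ((0 < people P a i)%N -> condL P alpha a i y) <-> y <= rho) ->
      wp (seti vI (iv vI + lit 1)) s3
        (fun t3 s4 => exists2 r', (r' < r)%N & J r' (t + (1 + (t2 + t3))).+1 s4).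
    move=> t2_G sI3 sY3 i_rho rho_max; apply: wp_storeI; exists (cap - i.+1)%N; first lia.
    exists i.+1, (Num.min Y rho); split.
    + by rewrite /= /update /= sI3; split=> //; lia.
    + by split; [rewrite subSn // mulnS /G; rewrite /G in t_i; lia|lia].
    + rewrite le_min aY ge_min Ycap /= andbT; apply: le_trans i_rho; apply: x_le; lia.
    + split; first lia.
      move=> i' ai' ii'; rewrite le_min; apply/andP; split.
        have [->|ne] := eqVneq i' i.+1; first exact: ltW.
        by apply: xY; lia.
      by apply: le_trans i_rho; apply: x_le; lia.
    + move=> y y_cap; rewrite le_min; split.
        move=> /andP[yY y_rho] i' ii' W'.
        have [iE|ne] := eqVneq i' i; last by move/Ymax: yY; apply=> //; lia.
        by rewrite iE in W' *; exact: (rho_max y y_cap yY).2 y_rho W'.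
      move=> H; have yY : y <= Y by apply/Ymax => // i' ii'; apply: H; lia.
      by rewrite yY; apply: (rho_max y y_cap yY).1 => W'; apply: H => //; lia.
  apply: wp_if => /=; rewrite {1}/update /= => W.
    have cl := clip_wp (s := s2) (a := a) (i := i) (cap := cap) (Y := Y) rdy2.
    apply: (wp_imp (cl _ _ _ _ _ _ _)) => //=; rewrite /update //=; try lia.
      by rewrite (fr.1 vCap).
    move=> t2 s3 fr3 [t2_lg [rho [sY3 i_rho rho_max]]].
    apply: (finish t2.+1 s3 rho) => //; first lia.
      by rewrite fr3.1 //= /update /= sI.
    by move=> y y_cap _; rewrite -rho_max //; split=> [|//]; apply; lia.
  apply: wp_skip; apply: (finish 2 s2 Y) => //; first lia.
  - by rewrite /= minxx.
  - exact: ltW.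
  - by move=> y _ yY; split=> // _; lia.
- move=> r t s1 fr [i [Y [[sI sY] [t_i r_i] /andP[aY Ycap] [ai xY] Ymax]]] /=.
  have [sz _ cc pre tab _ _ _ ta al xx] := ready_frame fr isT rdy0.
  rewrite sI sY xx ?negbK; last by lia.
  move=> Y_i.
  (* Vertices not scanned lie at or right of [Y], so their demands are vacuous. *)
  have reachY y : y <= x cap -> reachL P alpha a y <-> y <= Y.
    move=> y_cap; rewrite Ymax // reachL_condL; split=> [H i' ii'|H i' ai' W'].
      by apply: H; lia.
    have [ii|ii] := ltnP i' i; first by apply: H => //; lia.
    have [i'_n|] := leqP i' n; last by move=> ni e; lia.
    have y_i' : y <= x i'.
      apply: le_trans (le_trans ((Ymax y y_cap).2 H) Y_i) _.
      by apply: x_le; rewrite ii.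
    by apply: (condL_mono y_i'); exact: condL_here.
  have i_n : (i <= n)%N by lia.
  apply: wp_if => /=; rewrite sI sY xx // => iY.
    apply: wp_storeI; exists i.+1, Y; rewrite /= /update /=; split=> //; first last.
    + split; first lia.
      move=> j jn; rewrite ltnS; apply/idP/idP => [jY|ji].
        by apply: (@x_le_idx _ P) => //; exact: le_trans Y_i.
      by apply: le_trans iY; apply: x_le; rewrite ji.
    + by rewrite aY.
    + rewrite subSn // mulnS; lia.
    + by rewrite sI; split=> //; lia.
  have {}iY : Y < x i by rewrite ltNge.
  have a_i : (a < i)%N by apply: (@x_lt_idx _ P); [lia|exact: le_lt_trans iY].
  apply: wp_skip; exists i, Y; split=> //; first last.
  + split; first lia.
    move=> j jn; apply/idP/idP => [jY|ji].
      by apply: (@x_lt_idx _ P) => //; exact: le_lt_trans iY.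
    by apply: le_trans (xY i a_i (leqnn i)); apply: x_le; lia.
  + by rewrite aY.
  + by rewrite mulnS; lia.
exists a, (x cap); rewrite /= /update /= sA sCap (ready_x rdy); last by lia.
split=> //; first by rewrite subnn muln0; lia.
- by rewrite lexx x_le.
- by split=> // i'; lia.
- by move=> y y_cap; split=> // _ i'; lia.
Qed.
End SinkPhase.

(** * Cutting back the last vertex of a part *)

Section EndPhase.
Variables (R : realType) (P : dynpath R) (k lg : nat) (alpha : R).
Local Notation n := (dp_n P).
Local Notation x := (dp_x P).
Local Notation c := (dp_c P).
Local Notation tau := (dp_tau P).
Implicit Types s : state R.
Local Notation ready := (ready P k lg alpha).

Lemma descendR_wp s m q B v Y :
  ready s -> (0 < q <= B)%N -> (B <= n)%N -> least_cap P m q v ->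
  (forall e, (e <= n)%N -> (x e <= Y) = (e <= m)%N) ->
  imem s vQ (Posz 0) = q%:Z -> imem s vB (Posz 0) = B%:Z ->
  imem s vCm (Posz 0) = v%:Z -> rmem s rY (Posz 0) = Y ->
  imem s vPos (Posz 0) = q%:Z - 1 -> imem s vPp (Posz 0) = (2 ^ lg)%N%:Z ->
  wp descendR_prog s (fun t s' => (t <= 10 * (lg + 2))%N /\
    exists p, [/\ imem s' vPos (Posz 0) = p%:Z, (q.-1 <= p <= B)%N &
      forall b, (b <= B)%N -> condR P alpha Y q b <-> (b <= p)%N]).
Proof.
move=> rdy q_B B_n min_v Y_m sQ sB sCm sY sPos sPp.
pose J r t s' := (r <= lg.+1)%N /\ (t + 10 * r <= 10 * lg.+1)%N /\
  imem s' vPp (Posz 0) = ((2 ^ r) %/ 2)%N%:Z /\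
  exists p, [/\ imem s' vPos (Posz 0) = p%:Z, (q.-1 <= p <= B)%N, condR P alpha Y q p
    & forall z, (z <= B)%N -> condR P alpha Y q z -> (z < p + 2 ^ r)%N].
apply: (wp_while (J := J) (r := lg.+1)).
- move=> r t s' fr [r_lg [t_r [Pp [p [Pos qp Rp max_p]]]]] /=.
  rewrite Pp; case: r => [//|r] in r_lg t_r Pp max_p * => _.
  rewrite expnS mulKn // in Pp *.
  have [sz _ cc pre _ _ _ _ ta al xx] := ready_frame fr isT rdy.
  have finish p' s2 t2 : (t2 <= 8)%N -> imem s2 vPp (Posz 0) = (2 ^ r)%N%:Z ->
      imem s2 vPos (Posz 0) = p'%:Z -> (q.-1 <= p' <= B)%N -> condR P alpha Y q p' ->
      (forall z, (z <= B)%N -> condR P alpha Y q z -> (z < p' + 2 ^ r)%N) ->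
      wp (seti vPp (iv vPp / lit 2)) s2
        (fun t3 s3 => exists2 r', (r' < r.+1)%N & J r' (t + (t2 + t3)).+1 s3).
    move=> t2_8 Pp2 Pos2 qp2 Rp2 max2; apply: wp_storeI; exists r => //; split; first lia.
    split; first lia.
    by rewrite /= /update /= Pp2; split; [rewrite divz_nat|exists p'].
  apply: wp_seq; apply: wp_if => /=; rewrite Pos Pp fr.1 // sB => jump; last first.
    by apply: wp_skip; apply: (finish p) => // z; lia.
  have {}jump : (p + 2 ^ r <= B)%N by lia.
  apply: wp_seq; apply: wp_storeI => /=.
  have -> : imem s' 5 (imem s' vPos (Posz 0) + imem s' vPp (Posz 0) + 1%Z) -
      imem s' 5 (imem s' vQ (Posz 0)) = (people P q (p + 2 ^ r))%:Z.
    rewrite Pos Pp (fr.1 vQ) // sQ -prefix_people; last by lia.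
    have -> : p%:Z + (2 ^ r)%N%:Z + 1%Z = (p + 2 ^ r).+1%:Z by lia.
    by rewrite !pre //; lia.
  set s2 := State _ _.
  have next : condR P alpha Y q (p + 2 ^ r) ->
      forall z, (z <= B)%N -> condR P alpha Y q z -> (z < p + 2 ^ r + 2 ^ r)%N.
    by move=> _ z zB /(max_p z zB); rewrite expnS; lia.
  have jump_q : (q.-1 <= p + 2 ^ r <= B)%N by lia.
  apply: wp_if => /=; rewrite {1}/update /= => W.
    have Rj : condR P alpha Y q (p + 2 ^ r) by move=> W'; lia.
    apply: wp_storeI; apply: (finish (p + 2 ^ r)%N) => //=; rewrite /update //=; last exact: next.
    by rewrite Pos Pp.
  have test : (((people P q (p + 2 ^ r))%:Z - 1%Z) %/ imem s' vCm (Posz 0))%Z%:~R +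
      (rmem s' 1 (imem s' vQ (Posz 0)) - rmem s' rY (Posz 0)) * rmem s' 0 (Posz 0)
      <= rmem s' 0 (Posz 1) <-> condR P alpha Y q (p + 2 ^ r).
    rewrite !fr.1 // (fr.2 rY) // sQ sCm sY ta al xx; last by lia.
    have -> : (people P q (p + 2 ^ r))%:Z - 1%Z = (people P q (p + 2 ^ r)).-1%:Z by lia.
    rewrite divz_nat (condR_least _ _ min_v Y_m).
    by split=> [//|]; apply; lia.
  apply: wp_if => /=; rewrite {1 2 3}/update /=.
    move=> /test Rj; apply: wp_storeI.
    apply: (finish (p + 2 ^ r)%N) => //=; rewrite /update //=; last exact: next.
    by rewrite Pos Pp.
  move=> /negP NRj; apply: wp_skip; apply: (finish p) => // z zB Rz.
  rewrite ltnNge; apply/negP => zp; apply: NRj; apply/test.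
  exact: condR_mono zp Rz.
- move=> r t s' fr [r_lg [t_r [Pp [p [Pos qp Rp max_p]]]]] /=.
  rewrite Pp => stop; split; first by lia.
  have r0 : r = 0%N by case: r stop {max_p t_r Pp r_lg} => // r; rewrite expnS mulKn //; lia.
  exists p; split=> // b bB; split=> [/(max_p b bB)|bp]; first by rewrite r0; lia.
  exact: condR_mono bp Rp.
rewrite /J; split=> //; split; first lia.
split; first by rewrite sPp expnS mulKn.
(* A part that ends at [q.-1] excludes [x_q], so the demand is vacuous there. *)
exists q.-1; split.
- by rewrite sPos; lia.
- by lia.
- by apply: condR_before; lia.
- by move=> z zB _; have := ready_lg rdy; rewrite expnS; lia.
Qed.

Lemma end_wp s m cap Y : ready s -> (0 < m <= cap.+1)%N -> (cap <= n)%N ->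
  (forall i, (i <= n)%N -> (x i <= Y) = (i < m)%N) ->
  imem s vI (Posz 0) = m%:Z -> imem s vCap (Posz 0) = cap%:Z -> rmem s rY (Posz 0) = Y ->
  wp end_prog s (fun t s' => exists B, [/\ imem s' vB (Posz 0) = B%:Z,
    (t <= 30 * (lg + 2) * (B + 3 - m))%N, (m <= B.+1 <= cap.+1)%N &
    forall b, (b <= cap)%N -> reachR P alpha b Y <-> (b <= B)%N]).
Proof.
move=> rdy m_cap cap_n Y_m sI sCap sY.
have Y_m1 e : (e <= n)%N -> (x e <= Y) = (e <= m.-1)%N by move=> en; rewrite Y_m //; lia.
do 3 (apply: wp_seq; apply: wp_storeI => /=); set s0 := State _ _.
have rdy0 : ready s0 by do 3 (apply: ready_storeI => //); exact: ready_eta.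
set G := (30 * (lg + 2))%N.
(* Processing [x_q] never cuts below [q - 1], whence [q <= B + 2]: the number of rounds is bounded
   by the vertices kept, which is what makes the total time amortise. The capacity clause assumes
   [q <= n] because for [m = n.+1] no edge seeds the minimum. *)
pose J r t s' := exists q B, [/\ imem s' vQ (Posz 0) = q%:Z /\ imem s' vB (Posz 0) = B%:Z,
  (t <= G * (q - m))%N /\ (r + q = cap + 2)%N, (m <= B.+1 <= cap.+1)%N /\ (m <= q <= B + 2)%N,
  (q <= n)%N -> exists2 v, imem s' vCm (Posz 0) = v%:Z & least_cap P m.-1 (maxn m q.-1) v &
  forall b, (b <= cap)%N ->
    (forall i, (m <= i < q)%N -> condR P alpha Y i b) <-> (b <= B)%N].
apply: (wp_while (J := J) (r := (cap + 2 - m)%N)).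
- move=> r t s1 fr [q [B [[sQ sB] [t_q r_q] [mB mq] min_q max_B]]] /=.
  have rdy1 := ready_frame fr isT rdy0.
  have [sz _ cc pre tab _ len _ ta al xx] := rdy1.
  rewrite sQ sB lez_nat => q_B.
  have q_n : (q <= n)%N by lia.
  have [v Cm min_v] := min_q q_n; rewrite {min_q}.
  have min_q : least_cap P m.-1 q (minn v (c q)).
    have min1 : least_cap P q.-1 q (c q).
      by have := @least_cap1 _ P q.-1; rewrite prednK; [apply|]; lia.
    by apply: least_cap_cat min_v min1; lia.
  apply: wp_seq; apply: (wp_store_minI (u := v) (v := c q)) => //=.
    by rewrite sQ; apply: cc; lia.
  do 2 (apply: wp_seq; apply: wp_storeI => /=); apply: wp_seq; set s2 := State _ _.
  have rdy2 : ready s2 by do 3 (apply: ready_storeI => //); exact: ready_eta.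
  have dR := descendR_wp (s := s2) (m := m.-1) (q := q) (B := B) (Y := Y) rdy2 _ _ min_q Y_m1.
  apply: (wp_imp (dR _ _ _ _ _ _ _ _)); rewrite /= /update //=; try lia.
    by rewrite fr.2.
  move=> t2 s3 fr3 [t2_lg [p [Pos qp max_p]]].
  apply: wp_seq; apply: wp_storeI; apply: wp_storeI => /=.
  exists (cap + 2 - q.+1)%N; first lia.
  exists q.+1, p; split; rewrite /= /update /=.
  - by rewrite fr3.1 //= /update /= sQ Pos; split=> //; lia.
  - by split; [rewrite subSn ?mulnS; rewrite /G in t_q *; lia|lia].
  - by split; lia.
  - move=> _; exists (minn v (c q)); first by rewrite fr3.1.
    by have -> : maxn m q.+1.-1 = q by lia.
  - move=> b b_cap; split=> [H|bp i iq].
      have bB : (b <= B)%N by apply/max_B => // i iq; apply: H; lia.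
      by apply/max_p => //; apply: H; lia.
    have bB : (b <= B)%N by lia.
    have [iE|ne] := eqVneq i q; first by rewrite iE; apply/max_p.
    by move/(max_B b b_cap): bB; apply; lia.
- move=> r t s1 fr [q [B [[sQ sB] [t_q r_q] [mB mq] min_q max_B]]] /=.
  rewrite sQ sB lez_nat => q_B; exists B; split=> //.
    have : (q - m <= B + 2 - m)%N by lia.
    rewrite -(leq_pmul2l (_ : 0 < G)%N) => [le_G|]; last by rewrite /G; lia.
    have -> : (B + 3 - m = (B + 2 - m).+1)%N by lia.
    by rewrite mulnS; rewrite /G in le_G t_q *; lia.
  move=> b b_cap; rewrite -max_B // reachR_condR; split=> H i iq.
    have [ib|bi] := leqP i b; first by apply: H; lia.
    exact: condR_before.
  have bB := (max_B b b_cap).1 H; have [mi|im] := leqP m i; first by apply: H; lia.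
  move=> _ e ei; rewrite ltNge Y_m; lia.
exists m, cap; split; rewrite /= /update /=.
- by rewrite sI sCap.
- by rewrite subnn muln0; lia.
- by lia.
- move=> m_n; exists (c m); first by rewrite sI (ready_cap rdy) //; lia.
  rewrite (maxn_idPl _); last by lia.
  by have := @least_cap1 _ P m.-1; rewrite prednK; [apply|]; lia.
- by move=> b b_cap; split=> // _ i; lia.
Qed.
End EndPhase.

(** * One greedy part, and the preprocessing *)

Section Driver.
Variables (R : realType) (P : dynpath R) (k : nat) (alpha : R).
Local Notation n := (dp_n P).
Local Notation x := (dp_x P).
Local Notation w := (dp_w P).
Local Notation c := (dp_c P).
Implicit Types s : state R.

(** [b] is the first vertex after the part. Maximality ranges over all sinks, as [greedy_ahead]
    requires. *)
Definition part_ok a cap b y :=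
  [/\ (a < b <= cap.+1)%N, x a <= y <= x b.-1, reachL P alpha a y, reachR P alpha b.-1 y &
    forall b', (a <= b' <= cap)%N -> feasible P alpha a b' -> (b' < b)%N].

Lemma part_wp lg s j a : ready P k lg alpha s -> (j < k <= n.+1)%N -> (a <= n.+1 - k + j)%N ->
  imem s vJ (Posz 0) = j%:Z -> imem s vA (Posz 0) = a%:Z ->
  wp part_prog s (fun t s' => exists b y,
    [/\ imem s' vJ (Posz 0) = j.+1%:Z /\ imem s' vA (Posz 0) = b%:Z,
      (t < 150 * (lg + 2) * (b - a))%N,
      imem s' 4 = update (imem s) 4 (Posz j.+1) (Posz b) 4,
      rmem s' 2 = update (rmem s) 2 (Posz j) y 2 &
      part_ok a (n.+1 - k + j) b y]).
Proof.
move=> rdy jk a_cap sJ sA; set cap := (n.+1 - k + j)%N in a_cap *.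
have [sz pts _ _ _ _ _ _ _ _ _] := rdy.
apply: wp_seq; apply: wp_storeI => /=.
have -> : imem s 0 (Posz 0) - imem s 0 (Posz 1) + imem s vJ (Posz 0) = cap%:Z.
  by rewrite sz pts sJ /cap; lia.
set s0 := State _ _.
have rdy0 : ready P k lg alpha s0 by apply: ready_storeI => //; exact: ready_eta.
have cap_n : (cap <= n)%N by rewrite /cap; lia.
apply: wp_seq; apply: (wp_imp (sink_wp (a := a) (cap := cap) rdy0 _ _ _)).
- by rewrite a_cap.
- by [].
- by [].
move=> t1 s1 fr1 [m [Y [[I1 Y1] t1_le /andP[aY Ycap] [am Y_m] reachY]]].
have rdy1 := ready_frame fr1 isT rdy0.
apply: wp_seq; apply: (wp_imp (end_wp (m := m) (cap := cap) (Y := Y) rdy1 _ _ _ _ _ _)) => //.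
- by lia.
- by rewrite fr1.1.
move=> t2 s2 fr2 [B [B2 t2_le mB reachB]].
have rdy2 := ready_frame fr2 isT rdy1.
have xx := ready_x rdy2.
apply: wp_seq; apply: wp_storeI => /=.
have aB : (a <= B <= cap)%N by lia.
have LY : reachL P alpha a Y by apply/reachY.
have RB : reachR P alpha B Y by apply/reachB; lia.
apply: wp_seq; apply: wp_store_minR => /=; rewrite {2 3 4}/update /=.
apply: wp_seq; apply: wp_storeI => /=; apply: wp_storeI => /=.
exists B.+1, (Num.min Y (x B)); split.
- by rewrite /update /= (fr2.1 vJ) // (fr1.1 vJ) //= /update /= sJ B2; split; lia.
(* Both phases together cost [B + 4 - a] units, at most four for each of the [B.+1 - a] vertices of
   the part. *)
- have : (30 * (lg + 2) * ((m - a).+1 + (B + 3 - m)) <= 30 * (lg + 2) * (4 * (B.+1 - a)))%N.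
    by rewrite leq_mul2l; apply/orP; right; lia.
  rewrite mulnDr [X in (_ <= X)%N]mulnCA => le_t.
  have : (lg + 2 <= (lg + 2) * (B.+1 - a))%N by rewrite leq_pmulr; lia.
  rewrite -!mulnA in le_t t1_le t2_le *; lia.
- rewrite /update /= (fr2.1 4%N) // (fr1.1 4%N) // (fr2.1 vJ) // (fr1.1 vJ) //= /update /= B2 sJ.
  have -> : j%:Z + Posz 1 = j.+1%:Z by lia.
  by have -> : B%:Z + Posz 1 = B.+1%:Z by lia.
- rewrite /update /= (fr2.2 rY) // Y1 B2 xx; last by lia.
  by rewrite (fr2.1 vJ) // (fr1.1 vJ) //= (fr2.2 2%N) // (fr1.2 2%N) //= /update /= sJ.
split=> /=.
- by lia.
- by rewrite le_min aY ge_min lexx orbT !andbT x_le //; lia.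
- by apply: reachL_mono LY => //; rewrite ge_min lexx.
- have [YB|BY] := leP Y (x B); first exact: RB.
  by apply: reachR_end; lia.
(* A rival sink [y] is at most [Y]; moving it to [Y] only relaxes the demands from the right, so
   [reachB] bounds the rival end. *)
move=> b ab [y [/andP[ay yb] Ly Ry]]; rewrite ltnS; apply/reachB; first by lia.
have y_cap : y <= x cap by apply: le_trans yb (x_le _); lia.
by apply: reachR_mono Ry => //; apply/reachY.
Qed.

Lemma init_wp s : imem s 0 (Posz 0) = n.+1%:Z ->
  (forall i, (i <= n)%N -> imem s 1 (Posz i) = (w i)%:Z) ->
  (forall i, (0 < i <= n)%N -> imem s 2 (Posz i) = (c i)%:Z) ->
  imem s 5 (Posz 0) = 0 -> imem s vT (Posz 0) = 0 ->
  wp init_prog s (fun t s' => [/\ (t <= 5 * n.+2)%N,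
    forall i, (i <= n.+1)%N -> imem s' 5 (Posz i) = (prefix P i)%:Z &
    forall i, (i < n)%N -> imem s' 6 (Posz i) = (c i.+1)%:Z]).
Proof.
move=> sz sw sc s5 sT.
pose J r t s' := exists i, [/\ imem s' vT (Posz 0) = i%:Z, (r + i = n.+1)%N,
  (t <= 5 * i)%N,
  forall i', (i' <= i)%N -> imem s' 5 (Posz i') = (prefix P i')%:Z &
  forall i', (i' < i)%N -> (i' < n)%N -> imem s' 6 (Posz i') = (c i'.+1)%:Z].
apply: (wp_while (J := J) (r := n.+1)).
- move=> r t s' fr [i [T r_i t_i pre tab]] /=.
  rewrite T fr.1 // sz => i_n.
  do 3 (try apply: wp_seq; apply: wp_storeI => /=).
  have i1 : i%:Z + Posz 1 = i.+1%:Z by lia.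
  exists (n - i)%N; first lia.
  exists i.+1; rewrite /= /update /= T i1; split=> //; try lia.
    move=> i' ii'; case: eqVneq => [[->]|ne]; last by apply: pre; lia.
    by rewrite pre // fr.1 // sw; [rewrite /prefix big_nat_recr //= PoszD|lia].
  move=> i' ii' i'n; case: eqVneq => [[iE]|ne]; first by rewrite fr.1 // sc ?iE //; lia.
  by apply: tab => //; lia.
- move=> r t s' fr [i [T r_i t_i pre tab]] /=.
  rewrite T fr.1 // sz => i_n; split; first lia.
    by move=> i' ii'; apply: pre; lia.
  by move=> i' ii'; apply: tab; lia.
exists 0%N; split=> //; first by rewrite addn0.
by move=> i'; rewrite leqn0 => /eqP->; rewrite s5 /prefix big_geq.
Qed.

Definition table_upto l s := forall l' i, (l' <= l)%N -> (i + 2 ^ l' <= n)%N ->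
  exists2 v, least_cap P i (i + 2 ^ l') v & imem s 6 (Posz (l' * n.+1 + i)) = v%:Z.

Lemma row_wp s l : imem s 0 (Posz 0) = n.+1%:Z -> imem s vLev (Posz 0) = l%:Z ->
  imem s vLen (Posz 0) = (2 ^ l)%N%:Z -> imem s vT (Posz 0) = 0 -> table_upto l s ->
  wp row_prog s (fun t s' => (t <= 5 * n.+2)%N /\ table_upto l.+1 s').
Proof.
move=> sz sLev sLen sT tab.
pose J r t s' := exists i, [/\ imem s' vT (Posz 0) = i%:Z, (r + i = n.+1)%N,
  (t <= 5 * i)%N, table_upto l s' &
  forall i', (i' < i)%N -> (i' + 2 ^ l.+1 <= n)%N ->
    exists2 v, least_cap P i' (i' + 2 ^ l.+1) v &
      imem s' 6 (Posz (l.+1 * n.+1 + i')) = v%:Z].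
apply: (wp_while (J := J) (r := n.+1)).
- move=> r t s' fr [i [T r_i t_i tab' row]] /=.
  rewrite T fr.1 // sz => i_n.
  apply: wp_seq; apply: wp_store_minZ => /=; apply: wp_storeI => /=.
  have -> : imem s' vLev (Posz 0) * imem s' 0 (Posz 0) + imem s' vT (Posz 0) =
      Posz (l * n.+1 + i).
    by rewrite (fr.1 vLev) // (fr.1 0%N) // sLev sz T; lia.
  have -> : imem s' vLev (Posz 0) * imem s' 0 (Posz 0) +
      (imem s' vT (Posz 0) + imem s' vLen (Posz 0)) = Posz (l * n.+1 + (i + 2 ^ l)).
    by rewrite (fr.1 vLev) // (fr.1 0%N) // (fr.1 vLen) // sLev sLen sz T; lia.
  have -> : (imem s' vLev (Posz 0) + 1%Z) * imem s' 0 (Posz 0) + imem s' vT (Posz 0) =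
      Posz (l.+1 * n.+1 + i).
    by rewrite (fr.1 vLev) // (fr.1 0%N) // sLev sz T; lia.
  exists (n - i)%N; first lia.
  exists i.+1; rewrite /= /update /= T; split=> //; try lia.
    move=> l' i' ll' i'n; have [v min_v mem_v] := tab' l' i' ll' i'n.
    (* Cells of rows up to [l] lie before the start of row [l.+1], so the write misses them. *)
    exists v => //=; case: eqVneq => [[idx]|//].
    have : (l' * n.+1 <= l * n.+1)%N by rewrite leq_mul2r ll' orbT.
    by rewrite mulSn in idx; lia.
  move=> i' ii' i'n; case: eqVneq => [[idx]|ne]; last first.
    apply: row => //; rewrite ltn_neqAle -ltnS ii' andbT.
    by apply/eqP => ei; rewrite ei eqxx in ne.
  have iE : i' = i by lia.
  have {i_n} i_n : (i + 2 ^ l + 2 ^ l <= n)%N.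
    by rewrite -addnA addnn -mul2n -expnS -iE.
  rewrite iE.
  have [u min_u ->] : exists2 v, least_cap P i (i + 2 ^ l) v &
      imem s' 6 (Posz (l * n.+1 + i)) = v%:Z by apply: tab'; lia.
  have [v min_v ->] := tab' l (i + 2 ^ l)%N (leqnn l) i_n.
  exists (minn u v); last by lia.
  rewrite expnS mul2n -addnn addnA; apply: least_cap_cat min_u min_v; lia.
- move=> r t s' fr [i [T r_i t_i tab' row]] /=.
  rewrite T fr.1 // sz => i_n; split; first lia.
  move=> l' i'; rewrite leq_eqVlt => /orP[/eqP-> i'n|ll']; last exact: tab'.
  by apply: row => //; lia.
by exists 0%N; split=> //; rewrite addn0.
Qed.

Lemma table_wp s : imem s 0 (Posz 0) = n.+1%:Z -> imem s vLev (Posz 0) = 0 ->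
  (forall i, (i < n)%N -> imem s 6 (Posz i) = (c i.+1)%:Z) ->
  wp table_prog s (fun t s' => exists lg,
    [/\ imem s' vLev (Posz 0) = lg%:Z /\ imem s' vLen (Posz 0) = (2 ^ lg)%N%:Z,
      table_upto lg s', (n < 2 ^ lg <= 2 * n.+1)%N & (t <= 15 * n.+2 * lg.+1)%N]).
Proof.
move=> sz sLev s6; apply: wp_seq; apply: wp_storeI => /=; set s0 := State _ _.
pose J r t s' := exists l, [/\ imem s' vLev (Posz 0) = l%:Z,
  imem s' vLen (Posz 0) = (2 ^ l)%N%:Z, table_upto l s', (2 ^ l <= 2 * n.+1)%N /\ r = (n.+1 - l)%N &
  (t <= 15 * n.+2 * l)%N].
apply: (wp_while (J := J) (r := n.+1)).
- move=> r t s' fr [l [Lev Len tab [l_n r_l] t_l]] /=.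
  rewrite Len fr.1 //= /update /= sz => len_n.
  have l_lt : (l < 2 ^ l)%N by apply: ltn_expl.
  apply: wp_seq; apply: wp_storeI => /=; apply: wp_seq; set s1 := State _ _.
  apply: (wp_imp (row_wp (s := s1) (l := l) _ _ _ _ _)) => //; first by rewrite /= /update /= fr.1.
  move=> t2 s2 fr2 [t2_n tab2]; apply: wp_seq; apply: wp_storeI => /=; apply: wp_storeI => /=.
  exists (n.+1 - l.+1)%N; first lia.
  exists l.+1; rewrite /= /update /= !fr2.1 //= /update /= Lev Len; split.
  + lia.
  + by rewrite expnS; lia.
  + move=> l' i ll' i_n; have [v min_v mem_v] := tab2 l' i ll' i_n.
    by exists v.
  + by rewrite expnS; split=> //; lia.
  + by rewrite [X in (_ <= X)%N]mulnS; lia.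
- move=> r t s' fr [l [Lev Len tab [l_n r_l] t_l]] /=.
  rewrite Len fr.1 //= /update /= sz => len_n; exists l; split=> //; first lia.
  by rewrite mulnS; lia.
exists 0%N; rewrite /= /update /=; split=> //.
move=> l' i; rewrite leqn0 => /eqP-> i_n; exists (c i.+1).
  by rewrite expn0 addn1; apply: least_cap1; lia.
by rewrite /= /update /= mul0n add0n s6 //; lia.
Qed.
End Driver.

(** * The greedy answer and the complete run *)

Section Main.
Variables (R : realType) (P : dynpath R) (k : nat) (alpha : R).
Local Notation n := (dp_n P).
Local Notation x := (dp_x P).
Hypotheses (k_n : (1 <= k <= n.+1)%N) (alpha_gt0 : 0 < alpha).

Section Parts.
Variables (g : nat -> nat) (y : nat -> R).
Hypothesis g0 : g 0%N = 0%N.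
Hypothesis ok : forall j, (j < k)%N -> part_ok P alpha (g j) (n.+1 - k + j) (g j.+1) (y j).

Lemma parts_protocol : (n.+1 <= g k)%N -> protocol P k g y /\ protocol_time P k g y <= alpha.
Proof.
move=> n_gk; have p : protocol P k g y.
  split=> // [|j jk|j jk]; last 2 first.
  - by have [] := ok jk; lia.
  - by have [] := ok jk.
  apply/eqP; rewrite eqn_leq n_gk andbT /dp_size.
  have := @ok k.-1; rewrite prednK; last by lia.
  by case; lia.
split=> //; rewrite protocol_time_le ?(ltW alpha_gt0) // => j jk.
by have [] := ok jk.
Qed.

(** Greedy stays ahead of any protocol within [alpha], so [g k] reaches its last index [n.+1];
    conversely the greedy parts themselves form a protocol. *)
Lemma parts_answer : Theta_opt P k <= alpha <-> (n.+1 <= g k)%N.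
Proof.
rewrite Theta_opt_le ?(ltW alpha_gt0) //; split=> [[i [z [p le_alpha]]]|n_gk].
  have [_ ik _ sink] := p; rewrite -[n.+1]ik; move: le_alpha.
  rewrite protocol_time_le ?(ltW alpha_gt0) // => reach.
  apply: (greedy_ahead p (alpha := alpha)) => // j jk.
    by have [] := reach j jk; exists (z j); split=> //; exact: sink.
  have [gj _ _ _ max_g] := ok jk; split; first lia.
  exact: max_g.
by exists g, y; exact: parts_protocol.
Qed.
End Parts.

Lemma evac_wp : wp evac_prog (input P k alpha) (fun t s => exists lg,
  [/\ (2 ^ lg <= 2 * n.+1)%N, (t <= 400 * (n.+1 * (lg + 2)))%N,
      answers s (Theta_opt P k <= alpha) &
      Theta_opt P k <= alpha -> exists i y,
        [/\ outputs s k i y, protocol P k i y & protocol_time P k i y <= alpha]]).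
Proof.
set s0 := input P k alpha.
have s_w i : (i <= n)%N -> imem s0 1 (Posz i) = (dp_w P i)%:Z by move=> /= ->.
have s_c i : (0 < i <= n)%N -> imem s0 2 (Posz i) = (dp_c P i)%:Z by move=> /= ->.
have s_x i : (i <= n)%N -> rmem s0 1 (Posz i) = x i by move=> /= ->.
apply: wp_seq; apply: (wp_imp (init_wp (P := P) _ s_w s_c _ _)) => //.
move=> t1 s1 fr1 [t1_le pre1 tab1].
apply: wp_seq; apply: (wp_imp (table_wp (s := s1) _ _ tab1)); rewrite ?fr1.1 //.
move=> t2 s2 fr2 [lg [[lev2 len2] tab2 /andP[n_lg lg_n] t2_le]].
have rdy2 : ready P k lg alpha s2.
  have s1_x i : (i <= n)%N -> rmem s2 1 (Posz i) = x i.
    by move=> i_n; rewrite fr2.2 // fr1.2 // s_x.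
  have s1_c i : (0 < i <= n)%N -> imem s2 2 (Posz i) = (dp_c P i)%:Z.
    by move=> i_n; rewrite fr2.1 // fr1.1 // s_c.
  have s1_p i : (i <= n.+1)%N -> imem s2 5 (Posz i) = (prefix P i)%:Z.
    by move=> i_n; rewrite fr2.1 // pre1.
  by split=> //; rewrite ?fr2.1 ?fr1.1 ?fr2.2 ?fr1.2.
have out2 : imem s2 4 (Posz 0) = 0 by rewrite fr2.1 ?fr1.1.
set G := (150 * (lg + 2))%N.
(* Time is charged to the vertices consumed; the strict bound in [part_wp] pays for the loop test.
   The parts are read off the output arrays, from which [g] and [y] are recovered at the exit. *)
pose J r t s := exists j a, [/\ imem s vJ (Posz 0) = j%:Z /\ imem s vA (Posz 0) = a%:Z,
  (r + j = k)%N, (a <= n.+1 - k + j)%N /\ (t <= G * a)%N,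
  imem s 4 (Posz 0) = 0 /\ imem s 4 (Posz j) = a%:Z &
  forall j', (j' < j)%N -> exists g g', [/\ imem s 4 (Posz j') = g%:Z,
    imem s 4 (Posz j'.+1) = g'%:Z &
    part_ok P alpha g (n.+1 - k + j') g' (rmem s 2 (Posz j'))]].
apply: wp_seq; apply: (wp_while (J := J) (r := k)).
- move=> r t s fr [j [a [[sJ sA] r_j [a_cap t_a] [g0 gj] parts]]] /=.
  have rdy := ready_frame fr isT rdy2.
  rewrite sJ (ready_parts rdy) => jk; have {}jk : (j < k <= n.+1)%N by lia.
  apply: (wp_imp (part_wp rdy jk a_cap sJ sA)) => t' s' fr' [b [y [[sJ' sA'] t'_le E4 E2 ok]]].
  have [b_cap _ _ _ _] := ok.
  exists (k - j.+1)%N; first lia.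
  exists j.+1, b; split=> //; first lia.
  + split; first lia.
    have -> : (G * b = G * a + G * (b - a))%N by rewrite -mulnDr subnKC //; lia.
    by rewrite /G in t_a *; lia.
  + by rewrite E4 /update /= eqxx.
  move=> j'; rewrite ltnS leq_eqVlt => /orP[/eqP->|j'j].
    exists a, b; rewrite E4 E2 /update /= !eqxx; split=> //.
    by case: eqVneq => [[e]|//]; lia.
  have [g [g' [gE g'E ok']]] := parts j' j'j.
  exists g, g'; rewrite E4 E2 /update /=; split.
  + by case: eqVneq => [[e]|//]; lia.
  + by case: eqVneq => [[e]|//]; lia.
  + by case: eqVneq => [[e]|//]; lia.
- move=> r t s fr [j [a [[sJ sA] r_j [a_cap t_a] [g0 gj] parts]]] /=.
  have rdy := ready_frame fr isT rdy2.
  rewrite sJ (ready_parts rdy) => jk; have {r_j jk} jk : j = k by lia.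
  rewrite {j}jk in sJ a_cap gj parts.
  pose g j := `|imem s 4 (Posz j)|%N; pose y j := rmem s 2 (Posz j).
  have ok j : (j < k)%N -> part_ok P alpha (g j) (n.+1 - k + j) (g j.+1) (y j).
    by move=> /parts[h [h' [E E' ok]]]; rewrite /g E E'.
  have gk : g k = a by rewrite /g gj.
  have g0' : g 0%N = 0%N by rewrite /g g0.
  have gE j : (j <= k)%N -> imem s 4 (Posz j) = (g j)%:Z.
    rewrite leq_eqVlt => /orP[/eqP->|/parts[h [h' [E _ _]]]]; first by rewrite gk gj.
    by rewrite /g E.
  have time : (t1 + (t2 + (t.+1 + 2)) <= 400 * (n.+1 * (lg + 2)))%N.
    have a_n : (a <= n.+1)%N by lia.
    have : (G * a <= 150 * (n.+1 * (lg + 2)))%N.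
      by rewrite /G -mulnA [X in (_ <= _ * X)%N]mulnC !leq_mul2l a_n !orbT.
    have : (n.+2 * lg.+1 <= 2 * (n.+1 * (lg + 2)))%N by rewrite mulnA leq_mul //; lia.
    have : (n.+1 * 2 <= n.+1 * (lg + 2))%N by rewrite leq_mul2l leq_addl orbT.
    rewrite -mulnA in t2_le; lia.
  have final b s' : imem s' 3 (Posz 0) = (nat_of_bool b)%:Z -> imem s' 4 = imem s 4 ->
      rmem s' = rmem s -> b = (n.+1 <= g k)%N ->
      answers s' (Theta_opt P k <= alpha) /\
      (Theta_opt P k <= alpha -> exists i z,
        [/\ outputs s' k i z, protocol P k i z & protocol_time P k i z <= alpha]).
    move=> s3 s4 sr bE; have TE : (Theta_opt P k <= alpha) = b.
      by rewrite bE; apply/idP/idP => /(parts_answer g0' ok).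
    rewrite TE; split=> // bT; exists g, y.
    have [p le_alpha] : protocol P k g y /\ protocol_time P k g y <= alpha.
      by apply: parts_protocol => //; rewrite -bE.
    by split=> //; split=> j jk; rewrite ?s4 ?sr ?gE.
  apply: wp_if => /=; rewrite sA (ready_size rdy) lez_nat => n_a; apply: wp_storeI; exists lg.
    have [//|//|//||ans out] := final true (State (update (imem s) 3 (Posz 0) 1) (rmem s)).
      by rewrite gk n_a.
    by split.
  have [//|//|//||ans out] := final false (State (update (imem s) 3 (Posz 0) 0) (rmem s)).
    by rewrite gk (negbTE n_a).
  by split.
exists 0%N, 0%N; split=> //; rewrite ?fr2.1 ?fr1.1 //; lia.
Qed.
End Main.

(** Taking logarithms, [lg * ln 2 <= ln 2 + ln N], so [N * (lg + 2) * ln 2] is at most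
    [N * ln N + 3 * N * ln 2]. Since [N * ln 2 <= N * ln N + ln 2], this is at most
    [4 * N * ln N + 3 * ln 2]. The summand 1 in the bound covers [N = 1], where [N * ln N]
    vanishes. *)
Lemma log_bound (R : realType) lg N : (0 < N)%N -> (2 ^ lg <= 2 * N)%N ->
  (N * (lg + 2))%N%:R <= (4 / ln 2 + 3) * (N%:R * ln N%:R + 1) :> R.
Proof.
move=> N_gt0 lgN; have ln2_gt0 : 0 < ln (2 : R) by rewrite ln_gt0 // ltr1n.
have N_gt0' : 0 < N%:R :> R by rewrite ltr0n.
have lnN_ge0 : 0 <= ln (N%:R : R) by rewrite ln_ge0 // ler1n.
have lg_le : lg%:R * ln 2 <= ln 2 + ln (N%:R : R).
  rewrite -lnM ?posrE // -natrM mulr_natl -lnXn // -natrX.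
  by rewrite ler_ln ?posrE ?ltr0n ?expn_gt0 ?muln_gt0 // ler_nat.
have N_le : N%:R * ln 2 <= N%:R * ln (N%:R : R) + ln 2.
  case: N N_gt0 {lgN lg_le lnN_ge0} N_gt0' => // -[|N] _ N_gt0'.
    by rewrite !mul1r; have := ln2_gt0; rewrite ln1; lra.
  apply: ler_wpDr; first exact: ltW.
  by rewrite ler_pM2l // ler_ln ?posrE // ler_nat.
rewrite -(ler_pM2r ln2_gt0) natrM natrD mulrAC.
have -> : (4 / ln 2 + 3) * (N%:R * ln N%:R + 1) * ln 2 =
    (4 + 3 * ln 2) * (N%:R * ln N%:R + 1) :> R by field; rewrite gt_eqF.
have le1 : N%:R * (lg%:R * ln 2) <= N%:R * (ln 2 + ln N%:R) :> R by rewrite ler_pM2l.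
have : 0 <= (N%:R * ln N%:R : R) * ln 2 by rewrite !mulr_ge0 // ltW.
have : 0 <= N%:R * ln N%:R :> R by rewrite mulr_ge0 // ltW.
by lra.
Qed.

Theorem theorem3 (R : realType) :
  exists (prog : cmd) (C : R),
    forall (P : dynpath R) (k : nat) (alpha : R),
      (1 <= k <= dp_size P)%N -> 0 < alpha ->
      exists (t : nat) (s : state R),
        [/\ exec prog (input P k alpha) t s,
            t%:R <= C * ((dp_size P)%:R * ln (dp_size P)%:R + 1),
            answers s (Theta_opt P k <= alpha)
          & Theta_opt P k <= alpha ->
            exists (i : nat -> nat) (y : nat -> R),
              [/\ outputs s k i y, protocol P k i y
                & protocol_time P k i y <= alpha]].
Proof.
exists evac_prog, (400 * (4 / ln 2 + 3)) => P k alpha k_n alpha_gt0.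
have [t [s [ex [lg [lgN t_le ans out]]]]] := evac_wp k_n alpha_gt0.
exists t, s; split=> //; rewrite -mulrA.
apply: le_trans (_ : (400 * ((dp_n P).+1 * (lg + 2)))%N%:R <= _); first by rewrite ler_nat.
by rewrite natrM ler_pM2l // log_bound.
Qed.
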